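(* Let $(X,d)$ be a finite-dimensional Polish metric space, and let $\mathcal{W}$ be a uniformly bounded open cover of $X$. Then the natural bijection $\mathrm{Viet}(\mathcal{W})\to\mathrm{Viet}^{\mathrm{m}}(\mathcal{W})$, sending a point $\sum_i\lambda_i x_i$ of the geometric realization of $\mathrm{Viet}(\mathcal{W})$ to the measure $\sum_i\lambda_i\delta_{x_i}$, is a homotopy equivalence.
   Context: A Polish metric space is a metric space whose topology is separable and completely metrizable. Finite-dimensional refers to (Lebesgue) covering dimension. A cover $\mathcal{W}$ of $X$ is uniformly bounded if there is $D>0$ with $\mathrm{diam}(W)<D$ for all $W\in\mathcal{W}$. The Vietoris complex $\mathrm{Viet}(\mathcal{W})$ is the simplicial complex with vertex set $X$ in which a finite subset $\sigma\subseteq X$ is a simplex iff $\sigma$ is contained in some element of $\mathcal{W}$; it is identified with its geometric realization. The Vietoris metric thickening $\mathrm{Viet}^{\mathrm{m}}(\mathcal{W})$ is the set of finitely supported probability measures $\sum_{i=0}^{k-1}\lambda_i\delta_{x_i}$ on $X$ ($k\ge1$, $\lambda_i\ge0$, $\sum_i\lambda_i=1$) such that $\{x_0,\dots,x_{k-1}\}$ is contained in some element of $\mathcal{W}$, equipped with the $1$-Wasserstein (optimal transport) metric $d_{W^1}(\mu_1,\mu_2)=\inf_\mu\int_{X\times X}d(x,x')\,d\mu$, the infimum over couplings $\mu$ of $\mu_1$ and $\mu_2$. *)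

(* Defs.v *)
From HB Require Import structures.
From mathcomp Require Import all_boot all_order all_algebra.
From mathcomp Require Import all_classical all_reals all_analysis.
Set Implicit Arguments.
Unset Strict Implicit.
Unset Printing Implicit Defensive.
Import Order.TTheory GRing.Theory Num.Theory.
Import numFieldNormedType.Exports.
Local Open Scope classical_set_scope.
Local Open Scope ring_scope.

Section MetricNotions.
Context {R : realType} {X : choiceType}.

Definition is_metric (d : X -> X -> R) : Prop :=
  [/\ forall x y, 0 <= d x y,
      forall x y, d x y = 0 <-> x = y,
      forall x y, d x y = d y x &
      forall x y z, d x z <= d x y + d y z].

Definition dopen (d : X -> X -> R) (U : set X) : Prop :=
  forall x, U x -> exists2 r : R, 0 < r & [set y | d x y < r] `<=` U.

Definition dcauchy (d : X -> X -> R) (u : nat -> X) : Prop :=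
  forall e : R, 0 < e -> exists N : nat, forall m n : nat,
    (N <= m)%N -> (N <= n)%N -> d (u m) (u n) < e.
Definition dconverges (d : X -> X -> R) (u : nat -> X) (l : X) : Prop :=
  forall e : R, 0 < e -> exists N : nat, forall n : nat, (N <= n)%N -> d (u n) l < e.
Definition dcomplete (d : X -> X -> R) : Prop :=
  forall u : nat -> X, dcauchy d u -> exists l, dconverges d u l.

Definition dseparable (d : X -> X -> R) : Prop :=
  exists S : set X, countable S /\
    forall U : set X, dopen d U -> U !=set0 -> U `&` S !=set0.

Definition completely_metrizable (d : X -> X -> R) : Prop :=
  exists d' : X -> X -> R, [/\ is_metric d', dcomplete d' &
    forall U : set X, dopen d' U <-> dopen d U].

Definition polish_metric (d : X -> X -> R) : Prop :=
  [/\ is_metric d, dseparable d & completely_metrizable d].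

Definition covering_dim_le (d : X -> X -> R) (n : nat) : Prop :=
  forall (k : nat) (U : nat -> set X),
    (forall i, (i < k)%N -> dopen d (U i)) ->
    (forall x, exists2 i, (i < k)%N & U i x) ->
    exists (m : nat) (V : nat -> set X),
      [/\ forall j, (j < m)%N -> dopen d (V j),
          forall x, exists2 j, (j < m)%N & V j x,
          forall j, (j < m)%N -> exists2 i, (i < k)%N & V j `<=` U i &
          forall x, (count (fun j => `[< V j x >]) (iota 0 m) <= n.+1)%N].

Definition finite_dimensional (d : X -> X -> R) : Prop :=
  exists n : nat, covering_dim_le d n.

Definition diam (d : X -> X -> R) (U : set X) : \bar R :=
  ereal_sup [set (d x y)%:E | x in U & y in U].

Definition open_cover (d : X -> X -> R) (W : set (set X)) : Prop :=
  (forall U, W U -> dopen d U) /\ (forall x, exists2 U, W U & U x).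

Definition uniformly_bounded (d : X -> X -> R) (W : set (set X)) : Prop :=
  exists D : R, 0 < D /\ forall U, W U -> (diam d U < D%:E)%E.

Definition supp (f : X -> R) : set X := [set x | f x != 0].

(* Points of Viet(W) / Viet^m(W): finitely supported weight functions
   lambda >= 0 with total weight 1 whose support lies in a member of W.
   The weight function lambda represents both the formal convex combination
   sum_i lambda(x_i) x_i and the measure sum_i lambda(x_i) delta_{x_i}. *)
Definition viet_point (W : set (set X)) (f : X -> R) : Prop :=
  [/\ forall x, 0 <= f x,
      finite_set (supp f),
      \sum_(x \in supp f) f x = 1 &
      exists2 U, W U & supp f `<=` U].

Definition coupling (f g : X -> R) (p : X -> X -> R) : Prop :=
  [/\ forall x y, 0 <= p x y,
      forall x y, p x y != 0 -> supp f x /\ supp g y,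
      forall x, \sum_(y \in supp g) p x y = f x &
      forall y, \sum_(x \in supp f) p x y = g y].

Definition wasserstein1 (d : X -> X -> R) (f g : X -> R) : R :=
  inf [set \sum_(x \in supp f) \sum_(y \in supp g) p x y * d x y
      | p in coupling f g].

End MetricNotions.

Definition viet_pts (R : realType) (X : choiceType) (W : set (set X)) :=
  {f : X -> R | viet_point W f}.

(* Viet(W) with the topology of its geometric realization *)
Definition Viet (R : realType) (X : choiceType) (W : set (set X)) :=
  viet_pts R W.
(* Viet^m(W), with the topology of the 1-Wasserstein metric *)
Definition VietM (R : realType) (X : choiceType) (d : X -> X -> R)
  (W : set (set X)) := viet_pts R W.

HB.instance Definition _ (R : realType) (X : choiceType) W :=
  gen_eqMixin (@Viet R X W).
HB.instance Definition _ (R : realType) (X : choiceType) W :=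
  gen_choiceMixin (@Viet R X W).
HB.instance Definition _ (R : realType) (X : choiceType) d W :=
  gen_eqMixin (@VietM R X d W).
HB.instance Definition _ (R : realType) (X : choiceType) d W :=
  gen_choiceMixin (@VietM R X d W).

(* Coherent (weak) topology of the geometric realization: U is open iff its
   intersection with every closed simplex |s| (s a finite subset of a member
   of W) is open in the euclidean topology of |s|. *)
Definition viet_weak_open (R : realType) (X : choiceType) (W : set (set X))
  (U : set (Viet R W)) : Prop :=
  forall s : set X, finite_set s -> (exists2 V, W V & s `<=` V) ->
  forall p : Viet R W, U p -> supp (sval p) `<=` s ->
  exists2 e : R, 0 < e &
    forall q : Viet R W, supp (sval q) `<=` s ->
      (forall x, `|sval q x - sval p x| < e) -> U q.

HB.instance Definition _ (R : realType) (X : choiceType) W :=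
  isSubBaseTopological.Build (@Viet R X W) (@viet_weak_open R X W) id.

Definition wball (R : realType) (X : choiceType) (d : X -> X -> R)
  (W : set (set X)) (B : set (VietM d W)) : Prop :=
  exists (p : VietM d W) (r : R),
    B = [set q : VietM d W | wasserstein1 d (sval p) (sval q) < r].

HB.instance Definition _ (R : realType) (X : choiceType) d W :=
  isSubBaseTopological.Build (@VietM R X d W) (@wball R X d W) id.

Definition viet_to_metric (R : realType) (X : choiceType) (d : X -> X -> R)
  (W : set (set X)) : Viet R W -> VietM d W := fun p => p.

Definition homotopic (R : realType) (S T : topologicalType) (f g : S -> T) :=
  exists H : R * S -> T,
    [/\ {within [set ts : R * S | 0 <= ts.1 <= 1], continuous H},
        forall s, H (0, s) = f s &
        forall s, H (1, s) = g s].

Definition homotopy_equivalence (R : realType) (S T : topologicalType)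
  (f : S -> T) : Prop :=
  continuous f /\ exists g : T -> S,
    [/\ continuous g, homotopic R (g \o f) id & homotopic R (f \o g) id].

(* Main.v *)
Require Import Defs.
From mathcomp Require Import all_boot all_order all_algebra.
From mathcomp Require Import all_classical all_reals all_analysis.
From mathcomp Require Import ring lra.
Set Implicit Arguments.
Unset Strict Implicit.
Unset Printing Implicit Defensive.
Import Order.TTheory GRing.Theory Num.Theory.
Import numFieldNormedType.Exports.
Local Open Scope classical_set_scope.
Local Open Scope ring_scope.

(* Fix a countable family of Lipschitz bumps F_j, each positive only inside one
   member of W, such that every point nu of Viet^m(W) has some F_j equal to 1 on
   its whole support (finite unions of small balls around a countable dense set).
   The defect of F_j at nu is the integral of 1 - F_j.  Comparing the weights of
   the bumps whose defect is below the summable thresholds 2^-(j+3) yields a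
   Lipschitz function theta(z, nu) such that {theta(., nu) > 0} lies in a single
   member of W and meets the support of nu: theta discards the light points of nu
   which, in the Wasserstein metric, may be arbitrarily badly placed.

   Hence nu can be deformed inside its own simplex to its truncation by theta,
   and the truncation, inside another simplex, to a measure g(nu) carried by
   anchors chosen in {theta(., nu) > 0} from the dense set.  The anchors are
   locally finite in nu, so g is continuous into the weak topology, and the same
   two-stage deformation is continuous for both topologies. *)

(** * Couplings of finitely supported weights *)

Section Weights.
Context {R : realType} {X : choiceType}.
Implicit Types (s : seq X) (f g h F : X -> R) (p q : X -> X -> R).

Definition carried s f := forall x, f x != 0 -> x \in s.

Lemma carried_out s f x : carried s f -> x \notin s -> f x = 0.
Proof. by move=> sf xs; apply/eqP; apply: contraNT xs => /sf. Qed.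

Lemma fsum_carried s f F : uniq s -> carried s f ->
  (forall x, f x = 0 -> F x = 0) ->
  \sum_(x \in supp f) F x = \sum_(x <- s) F x.
Proof.
move=> us sf fF; apply: fsbig_fwiden => // x [_ /negP].
by rewrite /= negbK => /eqP/fF.
Qed.

Lemma finite_carried (A : set X) : finite_set A ->
  exists2 s, uniq s & forall x, A x -> x \in s.
Proof.
move=> /finite_seqP[s ->]; exists (undup s); first exact: undup_uniq.
by move=> x /=; rewrite mem_undup.
Qed.

Definition prob s f :=
  [/\ uniq s, carried s f, forall x, 0 <= f x & \sum_(x <- s) f x = 1].

Lemma viet_point_prob (W : set (set X)) s f : viet_point W f -> uniq s ->
  carried s f -> prob s f.
Proof.
move=> [f0 _ f1 _] us sf; split=> //.
by rewrite -(fsum_carried us sf).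
Qed.

(* [coupling] and its cost with all sums taken over one list [s] containing both
   supports; the choice of [s] is immaterial (see [nearby_carried]). *)
Definition coupled s f g p :=
  [/\ forall x y, 0 <= p x y,
      forall x y, p x y != 0 -> f x != 0 /\ g y != 0,
      forall x, \sum_(y <- s) p x y = f x &
      forall y, \sum_(x <- s) p x y = g y].

Definition cost (d : X -> X -> R) s p := \sum_(x <- s) \sum_(y <- s) p x y * d x y.

Lemma coupling_coupled s f g p : uniq s -> carried s f -> carried s g ->
  coupling f g p <-> coupled s f g p.
Proof.
move=> us sf sg; split=> -[p0 pfg p1 p2]; split=> //.
- move=> x; rewrite -p1 (fsum_carried us sg) // => y gy.
  by apply/eqP; apply: contraT => /pfg[_]; rewrite /supp/= gy eqxx.
- move=> y; rewrite -p2 (fsum_carried us sf) // => x fx.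
  by apply/eqP; apply: contraT => /pfg[]; rewrite /supp/= fx eqxx.
- move=> x; rewrite -p1 (fsum_carried us sg) // => y gy.
  by apply/eqP; apply: contraT => /pfg[_]; rewrite /supp/= gy eqxx.
- move=> y; rewrite -p2 (fsum_carried us sf) // => x fx.
  by apply/eqP; apply: contraT => /pfg[]; rewrite /supp/= fx eqxx.
Qed.

Lemma coupling_cost d s f g p : uniq s -> carried s f -> carried s g ->
  coupled s f g p ->
  \sum_(x \in supp f) \sum_(y \in supp g) p x y * d x y = cost d s p.
Proof.
move=> us sf sg [p0 pfg p1 p2].
have pz x y : f x = 0 \/ g y = 0 -> p x y = 0.
  move=> fg; apply/eqP; apply: contraT => /pfg[fx gy].
  by case: fg => e; rewrite e eqxx in fx gy.
rewrite (fsum_carried us sf) => [|x fx].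
  apply: eq_bigr => x _; rewrite (fsum_carried us sg) // => y gy.
  by rewrite pz ?mul0r//; right.
rewrite (fsum_carried us sg) => [|y gy].
  by rewrite big1// => y _; rewrite pz ?mul0r//; left.
by rewrite pz ?mul0r//; right.
Qed.

End Weights.

(** * Gluing, completing and integrating against couplings *)

Section Wasserstein.
Context {R : realType} {X : choiceType}.
Variable d : X -> X -> R.
Hypothesis dm : is_metric d.
Implicit Types (s : seq X) (f g h F : X -> R) (p q : X -> X -> R).

Let d0 x y : 0 <= d x y. Proof. by case: dm. Qed.
Let dT y x z : d x z <= d x y + d y z. Proof. by case: dm. Qed.

Lemma cost_ge0 s p : (forall x y, 0 <= p x y) -> 0 <= cost d s p.
Proof.
by move=> p0; apply: sumr_ge0 => x _; apply: sumr_ge0 => y _; exact: mulr_ge0.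
Qed.

Lemma wasserstein1_le_cost s f g p : uniq s -> carried s f -> carried s g ->
  coupled s f g p -> wasserstein1 d f g <= cost d s p.
Proof.
move=> us sf sg pc; apply: ge_inf.
  exists 0 => _ [q /(coupling_coupled _ us sf sg) qc <-].
  by rewrite (coupling_cost d us sf sg qc); apply: cost_ge0; case: qc.
exists p; first exact/(coupling_coupled _ us sf sg).
exact: (coupling_cost d us sf sg pc).
Qed.

Lemma coupled_prod s f g : prob s f -> prob s g ->
  coupled s f g (fun x y => f x * g y).
Proof.
move=> [us sf f0 f1] [_ sg g0 g1]; split.
- by move=> x y; exact: mulr_ge0.
- by move=> x y; rewrite mulf_eq0 negb_or => /andP.
- by move=> x; rewrite -mulr_sumr g1 mulr1.
- by move=> y; rewrite -mulr_suml f1 mul1r.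
Qed.

(** The product coupling shows that the set of costs is nonempty; on an empty set [inf] would be a
    default value and would give no coupling of cost below [r]. *)
Lemma wasserstein1_lt_cost s f g r : prob s f -> prob s g ->
  wasserstein1 d f g < r -> exists2 p, coupled s f g p & cost d s p < r.
Proof.
move=> pf pg; have := coupled_prod pf pg.
move: pf pg => [us sf _ _] [_ sg _ _] pc /inf_lt[|c [p pfg <-] pr].
  exists (cost d s (fun x y => f x * g y)), (fun x y => f x * g y).
    exact/(coupling_coupled _ us sf sg).
  exact: coupling_cost.
have cp := (coupling_coupled p us sf sg).1 pfg.
by exists p => //; rewrite -(coupling_cost d us sf sg cp).
Qed.

(** Gluing lemma behind the triangle inequality: [p x y * q y z / g y] makes the two couplings
    conditionally independent given the middle point. Where [g y = 0] both couplings vanish, so the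
    default value of the division is harmless. *)
Lemma coupled_glue s f g h p q : prob s f -> prob s g -> prob s h ->
  coupled s f g p -> coupled s g h q ->
  exists2 w, coupled s f h w & cost d s w <= cost d s p + cost d s q.
Proof.
move=> [us sf f0 f1] [_ sg g0 g1] [_ sh h0 h1] [p0 pfg p1 p2] [q0 qgh q1 q2].
have pq0 x y z : 0 <= p x y * q y z / g y.
  by rewrite !mulr_ge0 ?invr_ge0.
have pz x y : g y = 0 -> p x y = 0.
  by move=> gy; apply/eqP; apply: contraT => /pfg[_]; rewrite gy eqxx.
have qz y z : g y = 0 -> q y z = 0.
  by move=> gy; apply/eqP; apply: contraT => /qgh[]; rewrite gy eqxx.
have sumq x y : \sum_(z <- s) p x y * q y z / g y = p x y.
  rewrite -mulr_suml -mulr_sumr q1.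
  by have [/pz->|gy] := eqVneq (g y) 0; rewrite ?mul0r// mulfK.
have sump y z : \sum_(x <- s) p x y * q y z / g y = q y z.
  under eq_bigr do rewrite -mulrA.
  rewrite -mulr_suml p2.
  by have [/qz->|gy] := eqVneq (g y) 0; rewrite ?mul0r ?mulr0// mulrC divfK.
exists (fun x z => \sum_(y <- s) p x y * q y z / g y).
  split.
  - by move=> x z; apply: sumr_ge0.
  - move=> x z nz.
    have [y _ ] : exists2 y, y \in s & p x y * q y z / g y != 0.
      apply/hasP; apply: contraNT nz => /hasPn nz; apply/eqP.
      by rewrite big_seq big1// => y /nz; rewrite negbK => /eqP.
    rewrite !mulf_eq0 !negb_or => /andP[/andP[/pfg[? _] /qgh[_ ?]] _].
    by [].
  - by move=> x; rewrite exchange_big/= -[RHS]p1; apply: eq_bigr => y _.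
  - by move=> z; rewrite exchange_big/= -[RHS]q2; apply: eq_bigr => y _.
have -> : cost d s p = \sum_(x <- s) \sum_(z <- s) \sum_(y <- s)
    p x y * q y z / g y * d x y.
  apply: eq_bigr => x _; rewrite exchange_big/=; apply: eq_bigr => y _.
  by rewrite -mulr_suml sumq.
have -> : cost d s q = \sum_(x <- s) \sum_(z <- s) \sum_(y <- s)
    p x y * q y z / g y * d y z.
  rewrite [RHS]exchange_big/=; under [RHS]eq_bigr do rewrite exchange_big/=.
  rewrite [RHS]exchange_big/=; apply: eq_bigr => y _; apply: eq_bigr => z _.
  by rewrite -mulr_suml sump.
rewrite -big_split; apply: ler_sum => x _.
rewrite -big_split; apply: ler_sum => z _.
rewrite -big_split/= mulr_suml; apply: ler_sum => y _.
by rewrite -mulrDr ler_wpM2l.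
Qed.

(* Couple the mass not matched by [q] by the (normalized) product of the two
   leftovers; when nothing is left over, division by [0] yields the value [0]. *)
Lemma coupled_complete s f g q C : prob s f -> prob s g ->
  (forall x y, 0 <= q x y) ->
  (forall x y, q x y != 0 -> x \in s /\ y \in s) ->
  (forall x, \sum_(y <- s) q x y <= f x) ->
  (forall y, \sum_(x <- s) q x y <= g y) ->
  (forall x y, f x != 0 -> g y != 0 -> d x y <= C) ->
  exists2 w, coupled s f g w &
    cost d s w <= cost d s q + C * (1 - \sum_(x <- s) \sum_(y <- s) q x y).
Proof.
move=> [us sf f0 f1] [_ sg g0 g1] q0 qs q1 q2 dC0.
have qfg x y : q x y != 0 -> f x != 0 /\ g y != 0.
  move=> qxy; have [xs ys] := qs x y qxy.
  have {}qxy : 0 < q x y by rewrite lt_neqAle eq_sym qxy q0.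
  split; rewrite gt_eqF//; apply: lt_le_trans qxy _.
    apply: le_trans (q1 x); rewrite (bigD1_seq y)//= lerDl.
    exact: sumr_ge0.
  apply: le_trans (q2 y); rewrite (bigD1_seq x)//= lerDl.
  exact: sumr_ge0.
pose u x := f x - \sum_(y <- s) q x y.
pose v y := g y - \sum_(x <- s) q x y.
set m := \sum_(x <- s) _.
have u0 x : 0 <= u x by rewrite subr_ge0.
have v0 x : 0 <= v x by rewrite subr_ge0.
have su : \sum_(x <- s) u x = 1 - m by rewrite /u sumrB f1.
have sv : \sum_(x <- s) v x = 1 - m.
  by rewrite /v sumrB g1 /m exchange_big.
have m1 : 0 <= 1 - m by rewrite -su sumr_ge0.
have uf x : u x != 0 -> f x != 0.
  apply: contraNN => /eqP fx; rewrite /u fx big1 ?subr0// => y _.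
  by apply/eqP; apply: contraT => /qfg[]; rewrite fx eqxx.
have vg x : v x != 0 -> g x != 0.
  apply: contraNN => /eqP fx; rewrite /v fx big1 ?subr0// => y _.
  by apply/eqP; apply: contraT => /qfg[_]; rewrite fx eqxx.
have uz x : 1 - m = 0 -> u x = 0.
  move=> mz; have [xs|xs] := boolP (x \in s); last first.
    by apply/eqP; apply: contraNT xs => /uf/sf.
  apply/eqP; move/eqP: su; rewrite mz psumr_eq0// => /allP /(_ x xs)//.
have vz x : 1 - m = 0 -> v x = 0.
  move=> mz; have [xs|xs] := boolP (x \in s); last first.
    by apply/eqP; apply: contraNT xs => /vg/sg.
  apply/eqP; move/eqP: sv; rewrite mz psumr_eq0// => /allP /(_ x xs)//.
have r1 x : \sum_(y <- s) u x * v y / (1 - m) = u x.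
  rewrite -mulr_suml -mulr_sumr sv.
  by have [/uz->|mz] := eqVneq (1 - m) 0; rewrite ?mul0r// mulfK.
have r2 y : \sum_(x <- s) u x * v y / (1 - m) = v y.
  rewrite -mulr_suml -mulr_suml su mulrAC.
  by have [/vz->|mz] := eqVneq (1 - m) 0; rewrite ?mulr0// divff ?mul1r.
exists (fun x y => q x y + u x * v y / (1 - m)).
  split.
  - by move=> x y; rewrite addr_ge0 ?mulr_ge0 ?invr_ge0.
  - move=> x y; have [->|/qfg//] := eqVneq (q x y) 0.
    by rewrite add0r !mulf_eq0 !negb_or => /andP[/andP[/uf ? /vg ?] _].
  - by move=> x; rewrite big_split/= r1 addrC subrK.
  - by move=> y; rewrite big_split/= r2 addrC subrK.
rewrite /cost; under eq_bigr do under eq_bigr do rewrite mulrDl.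
under eq_bigr do rewrite big_split/=.
rewrite big_split/= lerD2l.
have -> : C * (1 - m) = \sum_(x <- s) \sum_(y <- s) u x * v y / (1 - m) * C.
  under eq_bigr do rewrite -mulr_suml r1.
  by rewrite -mulr_suml su mulrC.
apply: ler_sum => x _; apply: ler_sum => y _.
have [->|ux] := eqVneq (u x) 0; first by rewrite !mul0r.
have [->|vy] := eqVneq (v y) 0; first by rewrite !(mul0r,mulr0).
by rewrite ler_wpM2l ?mulr_ge0 ?invr_ge0// dC0 ?uf ?vg.
Qed.

(** Both sums are integrals against the same [p], by its two marginals. This is the easy half of
    Kantorovich duality, for two different integrands. *)
Lemma coupled_diff s f g p (F G : X -> R) : coupled s f g p ->
  `|\sum_(x <- s) f x * F x - \sum_(x <- s) g x * G x| <=
  \sum_(x <- s) \sum_(y <- s) p x y * `|F x - G y|.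
Proof.
move=> [p0 pfg p1 p2].
have -> : \sum_(x <- s) f x * F x = \sum_(x <- s) \sum_(y <- s) p x y * F x.
  by apply: eq_bigr => x _; rewrite -mulr_suml p1.
have -> : \sum_(x <- s) g x * G x = \sum_(x <- s) \sum_(y <- s) p x y * G y.
  by rewrite exchange_big/=; apply: eq_bigr => x _; rewrite -mulr_suml p2.
rewrite -sumrB (le_trans (ler_norm_sum _ _ _))// ler_sum// => x _.
rewrite -sumrB (le_trans (ler_norm_sum _ _ _))// ler_sum// => y _.
by rewrite -mulrBr normrM (ger0_norm (p0 _ _)).
Qed.

Lemma coupled_mass s f g p : prob s f -> coupled s f g p ->
  \sum_(x <- s) \sum_(y <- s) p x y = 1.
Proof.
by move=> [_ _ _ f1] [_ _ p1 _]; rewrite -[RHS]f1; apply: eq_bigr.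
Qed.

End Wasserstein.

(** * The truncation function and the anchors *)

Section RangeSup.
Context {R : realType} {T : Type}.
Implicit Types (a b : T -> R).

(** [sup] takes a default value on unbounded sets, so most lemmas below assume an upper bound
    [c]. *)
Definition rsup a : R := sup (range a).

Lemma rsup_ge a c i : (forall i, a i <= c) -> a i <= rsup a.
Proof.
move=> ac; apply: ub_le_sup; last by exists i.
by exists c => _ [j _ <-].
Qed.

Lemma rsup_le a c (i0 : T) : (forall i, a i <= c) -> rsup a <= c.
Proof.
by move=> ac; apply: ge_sup => [|_ [j _ <-]//]; exists (a i0), i0.
Qed.

Lemma rsup_gt a c (i0 : T) : c < rsup a -> exists i, c < a i.
Proof.
move=> /sup_gt[|_ [i _ <-] ci]; last by exists i.
by exists (a i0), i0.
Qed.

Lemma rsup_lip a b c e (i0 : T) : (forall i, a i <= c) -> (forall i, b i <= c) ->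
  (forall i, `|a i - b i| <= e) -> `|rsup a - rsup b| <= e.
Proof.
move=> ac bc ab; rewrite ler_distl; apply/andP; split.
  rewrite lerBlDr; apply: (rsup_le i0) => i.
  have := rsup_ge i ac; have := ab i; rewrite ler_distl => /andP[]; lra.
apply: (rsup_le i0) => i.
have := rsup_ge i bc; have := ab i; rewrite ler_distl => /andP[]; lra.
Qed.

End RangeSup.

Lemma max0_lip {R : realType} (x y : R) :
  `|Num.max 0 x - Num.max 0 y| <= `|x - y|.
Proof.
have := ler_norm (x - y); have := ler_norm (y - x); rewrite [`|y - x|]distrC.
rewrite ler_norml; case: (leP 0 x) => ?; case: (leP 0 y) => ? ? ?;
  by apply/andP; split; lra.
Qed.

(** * Closeness witnessed by a coupling *)

Section Nearby.
Context {R : realType} {X : choiceType}.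
Variable d : X -> X -> R.
Hypothesis dm : is_metric d.
Implicit Types (s : seq X) (f g h F : X -> R).

(** A Wasserstein bound that carries its coupling, so that estimates can use the coupling without
    knowing whether the infimum is attained. *)
Definition nearby c f g := exists s p,
  [/\ prob s f, prob s g, coupled s f g p & cost d s p <= c].

Lemma sum_diag s (F : X -> R) x : uniq s -> (x \notin s -> F x = 0) ->
  \sum_(y <- s) (if x == y then F x else 0) = F x.
Proof.
move=> us Fx; have [xs|xs] := boolP (x \in s); last first.
  by rewrite Fx// big1// => y _; case: ifP.
by rewrite (bigD1_seq x)//= eqxx big1 ?addr0// => y /negPf; rewrite eq_sym => ->.
Qed.

Lemma nearby_refl s f : prob s f -> nearby 0 f f.
Proof.
move=> pf; have [us sf f0 f1] := pf.
have out x : x \notin s -> f x = 0 by exact: carried_out.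
exists s, (fun x y => if x == y then f x else 0); split=> //; last first.
  rewrite /cost big1// => x _; rewrite big1// => y _.
  case: eqP => [->|_]; last by rewrite mul0r.
  by case: dm => _ /(_ y y)[_ ->]//; rewrite mulr0.
split.
- by move=> x y; case: ifP.
- by move=> x y; case: (x =P y) => [->//|]; rewrite eqxx.
- by move=> x; exact: (sum_diag us (@out x)).
- move=> y; rewrite -[RHS](sum_diag us (@out y)).
  by apply: eq_bigr => x _; rewrite eq_sym; case: eqP => // ->.
Qed.

Lemma nearby_ge0 c f g : nearby c f g -> 0 <= c.
Proof.
by move=> [s [p [_ _ [p0 _ _ _]]]]; apply: le_trans; exact: cost_ge0.
Qed.

Lemma nearby_carried c f g s : nearby c f g -> uniq s -> carried s f ->
  carried s g -> exists p, [/\ prob s f, prob s g, coupled s f g p & cost d s p <= c].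
Proof.
move=> [s' [p [pf pg pc pcost]]] us sf sg.
have [us' s'f f0 f1] := pf; have [_ s'g g0 g1] := pg.
have pfg : coupling f g p by apply/(coupling_coupled _ us' s'f s'g).
have pc' : coupled s f g p by apply/(coupling_coupled _ us sf sg).
exists p; split=> //.
- by split=> //; rewrite -(fsum_carried us sf)// (fsum_carried us' s'f).
- by split=> //; rewrite -(fsum_carried us sg)// (fsum_carried us' s'g).
- by rewrite -(coupling_cost d us sf sg pc') (coupling_cost d us' s'f s'g).
Qed.

Definition mean f F := \sum_(x \in supp f) f x * F x.

Lemma mean_carried s f F : uniq s -> carried s f ->
  mean f F = \sum_(x <- s) f x * F x.
Proof. by move=> us sf; rewrite /mean (fsum_carried us sf)// => x ->; rewrite mul0r. Qed.

Lemma coupled_affine s f g p L1 L2 : prob s f -> coupled s f g p ->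
  \sum_(x <- s) \sum_(y <- s) p x y * (L1 + L2 * d x y) = L1 + L2 * cost d s p.
Proof.
move=> pf pc; under eq_bigr do under eq_bigr do rewrite mulrDr.
under eq_bigr do rewrite big_split/= -mulr_suml.
rewrite big_split/= -mulr_suml (coupled_mass pf pc) mul1r; congr (_ + _).
rewrite /cost mulr_sumr; apply: eq_bigr => x _.
by rewrite mulr_sumr; apply: eq_bigr => y _; rewrite mulrCA.
Qed.

(** A coupling has total mass 1, so integrating the affine bound against it leaves the constant [L1]
    unchanged and turns [d] into the cost. *)
Lemma mean_nearby c f g F G L1 L2 : nearby c f g -> 0 <= L2 ->
  (forall x y, `|F x - G y| <= L1 + L2 * d x y) ->
  `|mean f F - mean g G| <= L1 + L2 * c.
Proof.
move=> [s [p [pf pg pc pcost]]] L20 FG.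
have [us sf f0 f1] := pf; have [_ sg g0 g1] := pg.
rewrite (mean_carried _ us sf) (mean_carried _ us sg).
apply: le_trans (coupled_diff _ _ pc) _.
have [p0 _ _ _] := pc.
apply: (@le_trans _ _ (\sum_(x <- s) \sum_(y <- s) p x y * (L1 + L2 * d x y))).
  by apply: ler_sum => x _; apply: ler_sum => y _; exact: ler_wpM2l.
rewrite (coupled_affine _ _ pf pc).
by rewrite lerD2l ler_wpM2l.
Qed.

End Nearby.

(** * Weights of the bumps and truncation of light points *)

Section Theta.
Context {R : realType} {X : choiceType}.
Variables (d : X -> X -> R) (F : nat -> X -> R) (k : nat -> R).
Hypothesis dm : is_metric d.
Hypothesis F01 : forall j x, 0 <= F j x <= 1.
Hypothesis k01 : forall j, 0 < k j <= 1.
Hypothesis Fk : forall j x y, k j * `|F j x - F j y| <= d x y.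
Implicit Types (s : seq X) (f g : X -> R).

Definition defect f j := mean f (fun x => 1 - F j x).
Definition bump_weight f j := k j * Num.max 0 (2^-1 ^+ j.+3 - defect f j).
(** The factor 2 makes [theta f z] vanish as soon as some bump of weight at least half the supremum
    is zero at [z]. *)
Definition theta f z := Num.max 0
  (rsup (bump_weight f) - 2 * rsup (fun j => bump_weight f j * (1 - F j z))).

Local Notation b := bump_weight.

Lemma defect_ge0 s f j : prob s f -> 0 <= defect f j.
Proof.
move=> [us sf f0 f1]; rewrite /defect (mean_carried _ us sf) sumr_ge0// => x _.
by rewrite mulr_ge0// subr_ge0; case/andP: (F01 j x).
Qed.

Lemma bump_weight_ge0 f j : 0 <= b f j.
Proof.
rewrite mulr_ge0//; first by case/andP: (k01 j) => /ltW.
by rewrite le_max lexx.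
Qed.

Lemma bump_weight_le s f j : prob s f -> b f j <= k j.
Proof.
move=> pf; have := defect_ge0 j pf => h; have /andP[k0 _] := k01 j.
rewrite /b ler_piMr ?(ltW k0)// ge_max ler01/=.
have : (2^-1 : R) ^+ j.+3 <= 1 by rewrite exprn_ile1// ?invr_ge0 ?ler0n ?invf_le1 ?ler1n.
by move: h; lra.
Qed.

Lemma bump_weight_le1 s f j : prob s f -> b f j <= 1.
Proof. by move=> /bump_weight_le /le_trans; apply; case/andP: (k01 j). Qed.

(** The integrand of [defect] is Lipschitz with constant [1 / k j], which the factor [k j] in the
    weight cancels; the bound is therefore uniform in [j] and passes to suprema. *)
Lemma bump_weight_lip c f g j : nearby d c f g -> `|b f j - b g j| <= c.
Proof.
move=> fg; have /andP[k0 _] := k01 j.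
rewrite -mulrBr normrM (gtr0_norm k0).
have H : `|defect f j - defect g j| <= 0 + (k j)^-1 * c.
  apply: mean_nearby fg _ _ => [|x y]; first by rewrite invr_ge0 ltW.
  rewrite add0r -(ler_pM2l k0) mulVKf ?gt_eqF// (le_trans _ (Fk j x y))//.
  have -> : 1 - F j x - (1 - F j y) = - (F j x - F j y) by ring.
  by rewrite normrN.
rewrite add0r -(ler_pM2l k0) mulVKf ?gt_eqF// in H.
apply: le_trans H; rewrite ler_pM2l// (le_trans (max0_lip _ _))//.
set e := _ ^+ _; have -> : e - defect f j - (e - defect g j) =
  - (defect f j - defect g j) by ring.
by rewrite normrN.
Qed.

Lemma bump_term_le1 s f z j : prob s f -> b f j * (1 - F j z) <= 1.
Proof.
move=> pf; have := bump_weight_le1 j pf; have := bump_weight_ge0 f j.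
by have /andP[? ?] := F01 j z => ? ?; rewrite mulr_ile1//; lra.
Qed.

Lemma theta_ge0 f z : 0 <= theta f z.
Proof. by rewrite le_max lexx. Qed.

Lemma bump_term_ge0 f z j : 0 <= b f j * (1 - F j z).
Proof. by rewrite mulr_ge0 ?bump_weight_ge0// subr_ge0; case/andP: (F01 j z). Qed.

Lemma theta_le1 s f z : prob s f -> theta f z <= 1.
Proof.
move=> pf; rewrite ge_max ler01/=.
have := rsup_le 0%N (fun j => bump_weight_le1 j pf).
have := rsup_ge 0%N (fun j => bump_term_le1 z j pf).
have := bump_term_ge0 f z 0; lra.
Qed.

Lemma theta_lip c f g z z' : nearby d c f g ->
  `|theta f z - theta g z'| <= 3 * c + 2 * d z z'.
Proof.
move=> fg; have [s [p [pf pg _ _]]] := fg.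
apply: le_trans (max0_lip _ _) _.
have := rsup_lip 0%N (fun j => bump_weight_le1 j pf)
  (fun j => bump_weight_le1 j pg) (fun j => bump_weight_lip j fg).
have : `|rsup (fun j => b f j * (1 - F j z)) -
         rsup (fun j => b g j * (1 - F j z'))| <= c + d z z'.
  apply: (rsup_lip 0%N (fun j => bump_term_le1 z j pf)
    (fun j => bump_term_le1 z' j pg)) => j.
  have -> : b f j * (1 - F j z) - b g j * (1 - F j z') =
    (b f j - b g j) * (1 - F j z) + b g j * (F j z' - F j z) by ring.
  rewrite (le_trans (ler_normD _ _))// lerD// normrM.
    have /andP[? ?] := F01 j z.
    by rewrite (le_trans _ (bump_weight_lip j fg))// ler_piMr// ger0_norm; lra.
  rewrite distrC (ger0_norm (bump_weight_ge0 _ _)) (le_trans _ (Fk j z z'))//.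
  by rewrite ler_wpM2r// (bump_weight_le j pg).
rewrite !ler_norml => /andP[? ?] /andP[? ?]; apply/andP; split; lra.
Qed.

(** The partial sum of the geometric series is exactly [4^-1 - 2^-1 ^+ n.+2]. *)
Lemma sum_half_lt n : \sum_(i < n) (2^-1 : R) ^+ i.+3 < 4^-1.
Proof.
have -> : \sum_(i < n) (2^-1 : R) ^+ i.+3 = 4^-1 - 2^-1 ^+ n.+2.
  elim: n => [|n IHn]; first by rewrite big_ord0 expr2; lra.
  by rewrite big_ord_recr/= IHn !exprS; lra.
by rewrite ltrBlDr ltrDl exprn_gt0// invr_gt0.
Qed.

(* The bumps with positive weight have total defect below 1/4, so they cannot
   all be avoided: some point of the support lies deep inside each of them. *)
Lemma bump_common_point s f : prob s f ->
  exists2 z, f z != 0 & forall j, 0 < b f j -> 3 / 4 <= F j z.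
Proof.
move=> pf; have [us sf f0 f1] := pf.
apply: contrapT => no.
have /choice[J HJ] : forall z, exists j,
    f z != 0 -> 0 < b f j /\ F j z < 3 / 4.
  move=> z; have [fz|fz] := eqVneq (f z) 0; first by exists 0.
  apply: contrapT => noj; apply: no; exists z => // j bj.
  rewrite leNgt; apply/negP => Fj.
  by apply: noj; exists j.
set n := (\max_(z <- s) J z).+1.
have Jn z : z \in s -> (J z < n)%N.
  by move=> zs; rewrite ltnS; apply: leq_bigmax_seq.
(* Double counting: every support point [z] loses more than 1/4 to its own bump [J z], whereas after
   exchanging the sums the total is a sum of defects, each below its threshold. *)
have : 4^-1 <= \sum_(z <- s) f z * \sum_(i < n | 0 < b f i) (1 - F i z).
  have -> : 4^-1 = \sum_(z <- s) f z * 4^-1 by rewrite -mulr_suml f1 mul1r.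
  rewrite big_seq [leRHS]big_seq.
  apply: ler_sum => z zs.
  have [->|fz] := eqVneq (f z) 0; first by rewrite !mul0r.
  rewrite ler_wpM2l//; have [bJ FJ] := HJ z fz.
  rewrite (bigD1 (Ordinal (Jn z zs)))//=.
  have : 0 <= \sum_(i < n | (0 < b f i) && (i != Ordinal (Jn z zs))) (1 - F i z).
    by rewrite sumr_ge0// => i _; have /andP[] := F01 i z; rewrite subr_ge0.
  by move: FJ; lra.
under eq_bigr do rewrite mulr_sumr.
rewrite exchange_big/= leNgt => /negP; apply.
apply: le_lt_trans (sum_half_lt n).
rewrite big_mkcond/=; apply: ler_sum => i _.
case: ifPn => [bi|_]; last by rewrite exprn_ge0// invr_ge0.
rewrite -(mean_carried (fun x => 1 - F i x) us sf) -/(defect f i).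
rewrite leNgt; apply/negP => /ltW dl; move: bi; rewrite /b.
by rewrite max_l ?mulr0 ?ltxx// subr_le0.
Qed.

(** At the common point [z] of the weighted bumps, each [b f i * (1 - F i z)] is at most [M / 4],
    whence [theta f z] is at least [M / 2]. A bump equal to 1 on the support has defect 0, so [M] is
    positive. *)
Lemma theta_gt0 s f : prob s f -> (exists j, forall x, f x != 0 -> F j x = 1) ->
  exists2 z, f z != 0 & 0 < theta f z.
Proof.
move=> pf [j Fj]; have [us sf f0 f1] := pf.
have [z fz Fz] := bump_common_point pf; exists z => //.
have bj : 0 < b f j.
  rewrite mulr_gt0//; first by case/andP: (k01 j).
  rewrite /defect (mean_carried _ us sf) big1 => [|x _].
    by rewrite subr0 lt_max exprn_gt0 ?orbT// invr_gt0.
  by have [->|/Fj->] := eqVneq (f x) 0; rewrite ?mul0r// subrr mulr0.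
have bM i := rsup_ge i (fun j => bump_weight_le1 j pf).
have := bM j; set M := rsup (b f) in bM * => bjM.
have : rsup (fun j => b f j * (1 - F j z)) <= M * 4^-1.
  apply: (rsup_le 0%N) => i; have := bump_weight_ge0 f i.
  rewrite le_eqVlt => /predU1P[<-|bi].
    by rewrite mul0r mulr_ge0 ?invr_ge0//; lra.
  have := Fz i bi; have := bM i; have /andP[? ?] := F01 i z => ? ?.
  by apply: ler_pM; lra.
by rewrite lt_max; move=> ?; apply/orP; right; rewrite -/M; lra.
Qed.

(** Any [j] of weight above [M / 2] works: if [F j z] were 0, the subtracted term would already
    exceed [M]. This confines the positivity set of [theta] to a single member of the cover. *)
Lemma theta_bump s f : prob s f -> exists j, forall z, 0 < theta f z -> 0 < F j z.
Proof.
move=> pf; pose M := rsup (b f).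
have [M0|M0] := leP M 0.
  exists 0 => z; rewrite lt_max ltxx/= -/M.
  have := rsup_ge 0%N (fun j => bump_term_le1 z j pf).
  by have := bump_term_ge0 f z 0; lra.
have [|j bj] := @rsup_gt _ _ (b f) (M / 2) 0%N; first by rewrite -/M; lra.
exists j => z; rewrite lt_max ltxx/= -/M => Mz.
have := rsup_ge j (fun j => bump_term_le1 z j pf) => bjz.
rewrite ltNge; apply/negP => Fz.
have : b f j <= b f j * (1 - F j z) by rewrite ler_peMr ?bump_weight_ge0//; lra.
by lra.
Qed.

(** * Locally finite anchors chosen from a countable dense set *)

Variable kappa : X -> R.
Hypothesis kappa01 : forall x, 0 <= kappa x <= 1.
Hypothesis kappa_fin : forall e, 0 < e -> finite_set [set x | e < kappa x].
Hypothesis kappa_dense : forall U, dopen d U -> U !=set0 ->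
  exists2 x, U x & 0 < kappa x.

Definition peak f := rsup (fun x => kappa x * theta f x).
(** Cutting at half the peak keeps at least one anchor and leaves only points with [kappa x] above
    [peak f / 2], which are finitely many once the peak is positive. *)
Definition anchor f x := Num.max 0 (kappa x * theta f x - peak f / 2).

Lemma ktheta_le1 s f x : prob s f -> kappa x * theta f x <= 1.
Proof.
move=> pf; have /andP[? ?] := kappa01 x.
by rewrite mulr_ile1// ?theta_ge0// (theta_le1 _ pf).
Qed.

Lemma ktheta_ge0 f x : 0 <= kappa x * theta f x.
Proof. by rewrite mulr_ge0 ?theta_ge0//; case/andP: (kappa01 x). Qed.

Lemma ktheta_lip c f g x : nearby d c f g ->
  `|kappa x * theta f x - kappa x * theta g x| <= 3 * c.
Proof.
move=> /(theta_lip x x); case: (dm) => _ /(_ x x)[_ ->]// _ _.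
rewrite mulr0 addr0 -mulrBr normrM => H; have /andP[? ?] := kappa01 x.
by rewrite (le_trans _ H)// ler_piMl// ger0_norm.
Qed.

Lemma prob_point s f : prob s f -> exists x, f x != 0.
Proof.
move=> [us sf f0 f1]; apply: contrapT => no.
have : \sum_(x <- s) f x = 0.
  rewrite big1// => x _; apply/eqP; apply: contrapT => fx.
  by apply: no; exists x; apply/negP.
by rewrite f1 => /eqP; rewrite oner_eq0.
Qed.

Lemma peak_lip c f g : nearby d c f g -> `|peak f - peak g| <= 3 * c.
Proof.
move=> fg; have [s [p [pf pg _ _]]] := fg.
have [x0 _] := prob_point pf.
exact: (rsup_lip x0 (fun x => ktheta_le1 x pf) (fun x => ktheta_le1 x pg)
  (fun x => ktheta_lip x fg)).
Qed.

Lemma anchor_ge0 f x : 0 <= anchor f x.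
Proof. by rewrite le_max lexx. Qed.

Lemma anchor_lip c f g x : nearby d c f g ->
  `|anchor f x - anchor g x| <= 5 * c.
Proof.
move=> fg; apply: le_trans (max0_lip _ _) _.
have := ktheta_lip x fg; have := peak_lip fg; have := nearby_ge0 dm fg => ?.
rewrite !ler_norml => /andP[? ?] /andP[? ?]; apply/andP; split; lra.
Qed.

(** The set where [theta f] is positive is nonempty and, by the Lipschitz bound in [z], open; hence
    it contains a point of positive [kappa]. *)
Lemma peak_gt0 s f : prob s f -> (exists j, forall x, f x != 0 -> F j x = 1) ->
  0 < peak f.
Proof.
move=> pf /(theta_gt0 pf)[z fz tz].
have [||x tx kx] := @kappa_dense [set x | 0 < theta f x].
- move=> x /= tx; exists (theta f x / 2); first by rewrite divr_gt0.
  move=> y /=; have := theta_lip x y (nearby_refl dm pf).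
  by rewrite mulr0 add0r ler_norml => /andP[? ?] ?; lra.
- by exists z.
- have := rsup_ge x (fun x => ktheta_le1 x pf); apply: lt_le_trans.
  exact: mulr_gt0.
Qed.

Lemma anchor_gt0 s f : prob s f -> (exists j, forall x, f x != 0 -> F j x = 1) ->
  exists x, 0 < anchor f x.
Proof.
move=> pf /(peak_gt0 pf) pk; have [x0 _] := prob_point pf.
have [|x xp] := @rsup_gt _ _ (fun x => kappa x * theta f x) (peak f / 2) x0.
  by rewrite -/(peak f); lra.
by exists x; rewrite lt_max subr_gt0 xp orbT.
Qed.

Lemma anchor_theta s f x : prob s f -> 0 < anchor f x -> 0 < theta f x.
Proof.
move=> pf; rewrite lt_max ltxx/= => H.
have := rsup_ge x (fun x => ktheta_le1 x pf); rewrite -/(peak f) => h.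
have /andP[? ?] := kappa01 x; have := ktheta_ge0 f x => h'.
rewrite lt_neqAle theta_ge0 andbT; apply: contraTneq H => <-.
by rewrite mulr0 in h h' *; rewrite -leNgt; lra.
Qed.

Lemma anchor_kappa s f x : prob s f -> 0 < anchor f x -> peak f / 2 < kappa x.
Proof.
move=> pf; rewrite lt_max ltxx/= subr_gt0 => /lt_le_trans; apply.
by have /andP[? ?] := kappa01 x; rewrite ler_piMr// (theta_le1 _ pf).
Qed.

(** For [c] below [peak f / 6] the peak drops by less than half, so every anchor of [g] satisfies
    [kappa x > peak f / 4], a condition that depends on [f] only. *)
Lemma anchor_locally_finite s f : prob s f ->
  (exists j, forall x, f x != 0 -> F j x = 1) ->
  exists2 A, finite_set A & exists2 r, 0 < r &
    forall c g x, c < r -> nearby d c f g -> 0 < anchor g x -> A x.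
Proof.
move=> pf /(peak_gt0 pf) pk.
exists [set x | peak f / 4 < kappa x]; first by apply: kappa_fin; rewrite divr_gt0.
exists (peak f / 6); first by rewrite divr_gt0.
move=> c g x cr fg; have [s' [p [_ pg _ _]]] := fg.
move=> /(anchor_kappa pg) /=; have := peak_lip fg; rewrite ler_norml.
by move=> /andP[]; lra.
Qed.

End Theta.

(** * Bumps subordinate to the cover *)

Section Existence.
Context {R : realType} {X : choiceType}.
Implicit Types (f : X -> R).

(** Minimum of finitely many radii, for properties inherited by smaller radii. *)
Lemma seq_uniform_pos (T : eqType) (s : seq T) (P : T -> R -> Prop) :
  (forall a r r', P a r -> 0 < r' -> r' <= r -> P a r') ->
  (forall a, a \in s -> exists2 r, 0 < r & P a r) ->
  exists2 r, 0 < r & forall a, a \in s -> P a r.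
Proof.
move=> Pmono; elim: s => [|a s IHs] Ps; first by exists 1.
have [|r r0 Pr] := IHs; first by move=> b bs; apply: Ps; rewrite in_cons bs orbT.
have [r' r'0 Pr'] := Ps a (mem_head _ _).
have m0 : 0 < Num.min r r' by rewrite lt_min r0.
exists (Num.min r r') => // b; rewrite in_cons => /predU1P[->|/Pr Pb].
  by apply: (Pmono _ _ _ Pr') => //; rewrite ge_min lexx orbT.
by apply: (Pmono _ _ _ Pb) => //; rewrite ge_min lexx.
Qed.

Lemma exp_half_lt (e : R) : 0 < e -> exists n, 2^-1 ^+ n < e.
Proof.
move=> e0; exists (Num.bound e^-1).
rewrite exprVn -[ltRHS]invrK ltf_pV2 ?posrE ?invr_gt0 ?exprn_gt0//.
exact: upper_nthrootP.
Qed.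

Variable d : X -> X -> R.
Hypothesis dm : is_metric d.
Hypothesis sep : dseparable d.

Lemma exists_dense_weight : exists kappa : X -> R,
  [/\ forall x, 0 <= kappa x <= 1,
      forall e, 0 < e -> finite_set [set x | e < kappa x] &
      forall U, dopen d U -> U !=set0 -> exists2 x, U x & 0 < kappa x].
Proof.
have [S [/countable_injP[c cinj] Sd]] := sep.
exists (fun x => if `[< S x >] then 2^-1 ^+ c x else 0); split.
- move=> x; case: ifP => _; last by rewrite lexx ler01.
  by rewrite exprn_ge0 ?exprn_ile1 ?invr_ge0 ?invf_le1 ?ler1n.
- move=> e e0; have [N Ne] := exp_half_lt e0.
  (* The shift by one reserves the value 0 for points outside [S], so [c'] is injective on the
     preimage of the positive integers. *)
  pose c' x := if `[< S x >] then (c x).+1 else 0%N.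
  apply: (@sub_finite_set _ _ (c' @^-1` [set i | 0 < i <= N.+1]%N)).
    move=> x /=; rewrite /c'; case: asboolP => [Sx|_]; last by rewrite ltNge (ltW e0).
    move=> ex; apply/andP; split=> //; rewrite ltnS leqNgt; apply/negP => Nc.
    suff : (2^-1 : R) ^+ c x <= 2^-1 ^+ N by move: ex Ne; lra.
    by rewrite ler_wiXn2l ?invr_ge0 ?invf_le1 ?ler1n// ltnW.
  apply: finite_preimage; last first.
    by apply: (sub_finite_set _ (finite_II N.+2)) => i /= /andP[_].
  move=> x y; rewrite !inE /= /c'.
  case: asboolP => Sx //; case: asboolP => Sy // _ _ [cxy].
  by apply: cinj; rewrite ?inE.
- move=> U Uo /(Sd _ Uo)[x [Ux Sx]]; exists x => //.
  by rewrite asboolT// exprn_gt0// invr_gt0.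
Qed.

Variable W : set (set X).
Hypothesis Wc : open_cover d W.

Let d0 x y : 0 <= d x y. Proof. by case: dm. Qed.
Let dxx x : d x x = 0. Proof. by case: dm => _ /(_ x x)[_ ->]. Qed.
Let dC x y : d x y = d y x. Proof. by case: dm. Qed.
Let dT y x z : d x z <= d x y + d y z. Proof. by case: dm. Qed.

Definition tent (x : R) := Num.max 0 (Num.min 1 (2 - x)).

Lemma tent_lip x y : `|tent x - tent y| <= `|x - y|.
Proof.
apply: le_trans (max0_lip _ _) _.
have := ler_norm (x - y); have := ler_norm (y - x); rewrite [`|y - x|]distrC.
rewrite ler_norml; case: (leP 1 (2 - x)) => ?; case: (leP 1 (2 - y)) => ? ? ?;
  by apply/andP; split; lra.
Qed.

Lemma tent01 x : 0 <= tent x <= 1.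
Proof. by rewrite le_max lexx ge_max ler01 ge_min lexx. Qed.

Lemma tent_gt0 x : 0 < tent x -> x < 2.
Proof. by rewrite lt_max ltxx lt_min => /andP[_]; rewrite subr_gt0. Qed.

Lemma tent1 x : x <= 1 -> tent x = 1.
Proof. by move=> x1; rewrite /tent min_l ?max_r//; lra. Qed.

(* [1] on the balls of radius [2^-m] around the [e n] with [n \in l], and [0]
   outside the balls of radius [2 * 2^-m]. *)
Definition bump (e : nat -> X) (l : seq nat) (m : nat) x : R :=
  rsup (fun n => if n \in l then tent (2 ^+ m * d x (e n)) else 0).

Lemma bump01 e l m x : 0 <= bump e l m x <= 1.
Proof.
have H n : 0 <= (if n \in l then tent (2 ^+ m * d x (e n)) else 0) <= 1.
  by case: ifP => _; [exact: tent01|rewrite lexx ler01].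
apply/andP; split; last by apply: (rsup_le 0%N) => n; case/andP: (H n).
apply: (le_trans _ (@rsup_ge _ _ _ 1 0%N _)); first by case/andP: (H 0%N).
by move=> n; case/andP: (H n).
Qed.

Lemma bump_lip e l m x y : `|bump e l m x - bump e l m y| <= 2 ^+ m * d x y.
Proof.
apply: (@rsup_lip _ _ _ _ 1 _ 0%N) => n.
- by case: ifP => _ //; case/andP: (tent01 (2 ^+ m * d x (e n))).
- by case: ifP => _ //; case/andP: (tent01 (2 ^+ m * d y (e n))).
have e0 : 0 <= (2 : R) ^+ m by rewrite exprn_ge0.
case: ifP => _; last by rewrite subrr normr0 mulr_ge0.
rewrite (le_trans (tent_lip _ _))// -mulrBr normrM ger0_norm// ler_wpM2l//.
have := dT y x (e n); have := dT x y (e n); rewrite (dC y x).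
by rewrite ler_norml => ? ?; apply/andP; split; lra.
Qed.

Lemma bump_gt0 e l m x : 0 < bump e l m x ->
  exists2 n, n \in l & 2 ^+ m * d x (e n) < 2.
Proof.
by move=> /(rsup_gt 0%N)[n]; case: ifP => [nl /tent_gt0|]; [exists n|rewrite ltxx].
Qed.

Lemma bump1 e l m x n : n \in l -> 2 ^+ m * d x (e n) <= 1 -> bump e l m x = 1.
Proof.
move=> nl dx; apply/eqP; rewrite eq_le; case/andP: (bump01 e l m x) => _ ->/=.
apply: (le_trans _ (@rsup_ge _ _ _ 1 n _)); first by rewrite nl tent1.
by move=> i; case: ifP => _ //; case/andP: (tent01 (2 ^+ m * d x (e i))).
Qed.

(** The pairs formed by a finite list of dense points and a dyadic scale are countably many, and the
    bumps they define reach 1 on every finite set lying in a member of [W]. *)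
Lemma exists_bumps : exists (F : nat -> X -> R) (k : nat -> R),
  [/\ (forall j x, 0 <= F j x <= 1) /\ (forall j, 0 < k j <= 1),
      forall j x y, k j * `|F j x - F j y| <= d x y,
      forall j, (exists x, 0 < F j x) ->
        exists2 U, W U & forall x, 0 < F j x -> U x &
      forall f, viet_point W f -> exists j, forall x, f x != 0 -> F j x = 1].
Proof.
(* A point [x0] is needed as default value to enumerate the dense set; the empty space is settled at
   the end. *)
have [noX|/existsNP[x0 _]] := pselect (forall x : X, False); last first.
  have [S [/countable_injP[c cinj] Sd]] := sep.
  pose e n := xget x0 [set x | S x /\ c x = n].
  have eK x : S x -> e (c x) = x.
    move=> Sx; rewrite /e; case: xgetP => [y _ [Sy cy]|/(_ x)/= []//].
    by apply: cinj; rewrite ?inE.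
  have edense a r : 0 < r -> exists n, d a (e n) < r.
    move=> r0; have [||x [ax Sx]] := Sd [set x | d a x < r].
    - move=> y /= ay; exists (r - d a y); first by rewrite subr_gt0.
      by move=> z /= yz; have := dT y a z; lra.
    - by exists a; rewrite /= dxx.
    by exists (c x); rewrite eK.
  pose ok l m := `[< exists2 U, W U & forall x, 0 < bump e l m x -> U x >].
  pose idx j := odflt ([::], 0%N) (unpickle j : option (seq nat * nat)).
  (* Candidates not subordinate to [W] are replaced by 0, so that every index gives an admissible
     bump. *)
  pose F j x := if ok (idx j).1 (idx j).2 then bump e (idx j).1 (idx j).2 x else 0.
  exists F, (fun j => 2^-1 ^+ (idx j).2); split.
  - split=> j; first move=> x.
      by rewrite /F; case: ifP => _; [exact: bump01|rewrite lexx ler01].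
    by rewrite exprn_gt0 ?exprn_ile1 ?invr_ge0 ?invr_gt0 ?invf_le1 ?ler1n.
  - move=> j x y; rewrite /F; case: ifP => _; last by rewrite subrr normr0 mulr0.
    rewrite exprVn mulrC ler_pdivrMr ?exprn_gt0// mulrC; exact: bump_lip.
  - by move=> j [x]; rewrite /F; case: ifP => [/asboolP|]; rewrite ?ltxx.
  move=> f [f0 /finite_seqP[s fs] _ [U WU fU]].
  have Uo : dopen d U by case: Wc => + _; apply.
  have [||r r0 rP] := @seq_uniform_pos _ s
      (fun a r => [set y | d a y < r] `<=` U).
  - by move=> a r r' sub r'0 r'r y /= ay; apply: sub => /=; lra.
  - move=> a as_; have /fU : supp f a by rewrite fs.
    by move=> /Uo[r]; exists r.
  (* The dense point chosen for [a] is within [2^-m] of [a], and the bump reaches [2 * 2^-m] around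
     it: in all less than [3 * 2^-m < r] from [a]. *)
  have [|m mr] := @exp_half_lt (r / 3); first by rewrite divr_gt0.
  have m0 : 0 < (2^-1 : R) ^+ m by rewrite exprn_gt0// invr_gt0.
  have /choice[N NP] : forall a, exists n, d a (e n) < 2^-1 ^+ m.
    by move=> a; exact: edense.
  have scale x : 2 ^+ m * (2^-1 ^+ m * x) = x :> R.
    by rewrite exprVn mulVKf// expf_neq0.
  have p0 : 0 < (2 : R) ^+ m by rewrite exprn_gt0.
  have okNm : ok [seq N a | a <- s] m.
    apply/asboolP; exists U => // x /bump_gt0[_ /mapP[a as_ ->]].
    move=> dx2; have dx : d x (e (N a)) < 2^-1 ^+ m * 2.
      by rewrite -(ltr_pM2l p0) scale.
    apply: (rP a as_) => /=.
    have := dT (e (N a)) a x; have := NP a; rewrite (dC (e (N a))); lra.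
  exists (pickle ([seq N a | a <- s], m)) => x fx.
  have -> : F (pickle ([seq N a | a <- s], m)) x = bump e [seq N a | a <- s] m x.
    by rewrite /F /idx pickleK/= okNm.
  have xs : x \in s by have : supp f x by []; rewrite fs.
  apply: (@bump1 _ _ _ _ (N x)); first by rewrite map_f.
  have := ltW (NP x); rewrite -(ler_pM2l p0) => /le_trans; apply.
  by have := scale 1; rewrite mulr1 => ->.
exists (fun _ _ => 0), (fun _ => 1); split.
- by split=> *; rewrite ?lexx ?ltr01 ?ler01.
- by move=> j x; case: (noX x).
- by move=> j [x]; case: (noX x).
- by move=> f _; exists 0%N => x; case: (noX x).
Qed.

End Existence.

(** * The two topologies *)

Definition simplex {X : choiceType} (W : set (set X)) (s : seq X) :=
  exists2 U, W U & forall x, x \in s -> U x.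

Section VietTopology.
Context {R : realType} {X : choiceType} {W : set (set X)}.
Implicit Types (p q : Viet R W) (s : seq X).

Lemma viet_carried p : exists2 s, uniq s & carried s (sval p).
Proof. by have [_ /finite_carried[s us sp] _ _] := svalP p; exists s. Qed.

Lemma weak_open_nbhs (V : set (Viet R W)) p : viet_weak_open V -> V p -> nbhs p V.
Proof.
move=> Vo Vp; rewrite nbhsE; exists V => //; split=> //.
rewrite /open /=; exists [set V]; last by rewrite bigcup_set1.
by move=> _ ->; exact: (@finI_from1 (set (Viet R W)) _ (@viet_weak_open R X W) id V Vo).
Qed.

(** Weakly open sets are stable under finite intersections, so the subbase that defines the topology
    is already a base. *)
Lemma nbhs_weak_open p (B : set (Viet R W)) : nbhs p B ->
  exists V, [/\ viet_weak_open V, V p & V `<=` B].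
Proof.
rewrite nbhsE => -[V [oV Vp] VB]; move: oV; rewrite /open /= => -[D' D'f D'V].
move: Vp; rewrite -D'V => -[A D'A Ap]; exists A; split=> //; last first.
  by apply: subset_trans VB; rewrite -D'V; exact: bigcup_sup.
have [E Eo EA] := D'f A D'A.
move=> s fs sW q Aq qs.
have [||r r0 rP] := @seq_uniform_pos R _ (finmap.enum_fset E)
  (fun U e => forall q' : Viet R W, supp (sval q') `<=` s ->
      (forall x, `|sval q' x - sval q x| < e) -> U q').
- move=> U e e' UP e'0 e'e q' q's q'q; apply: UP => // x.
  exact: lt_le_trans (q'q x) e'e.
- move=> U UE; have := Eo U UE.
  rewrite inE => /(_ s fs sW q)[]//.
    by move: Aq; rewrite -EA; apply.
  by move=> e e0 eP; exists e.
exists r => // q' q's q'q; rewrite -EA => U UE; exact: (rP U UE).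
Qed.

(* The simplices inside a finite vertex set [A] are finitely many, and [q]
   close to [p] lies in one of them that also contains [p]. *)
Lemma weak_open_carried (V : set (Viet R W)) p (A : seq X) :
  viet_weak_open V -> V p ->
  exists2 e : R, 0 < e & forall q, carried A (sval q) ->
    (forall x, `|sval q x - sval p x| < e) -> V q.
Proof.
move=> Vo Vp; have [sp _ spp] := viet_carried p.
pose T := [seq mask (tval m) A | m <- enum {: (size A).-tuple bool}].
have [||e1 e10 e1P] := @seq_uniform_pos R _ T
  (fun t e => simplex W t -> carried t (sval p) ->
    forall q, carried t (sval q) ->
    (forall x, `|sval q x - sval p x| < e) -> V q).
- move=> t e e' H e'0 e'e st pt q qt qp; apply: H => // x.
  exact: lt_le_trans (qp x) e'e.
- move=> t _; have [[[U WU tU] pt]|no] := pselect (simplex W t /\ carried t (sval p)).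
    have [|x /pt|e e0 eP] := Vo [set` t] (finite_seq t) _ p Vp; first by exists U.
    - by [].
    - by exists e => // _ _ q qt; apply: eP => x /qt.
  by exists 1 => // st pt; case: no.
(* [e2] is a lower bound for the positive weights of [p]: a point [q] closer than [e2] is nonzero on
   the whole support of [p], so the support of [q] spans a simplex containing both. *)
have [||e2 e20 e2P] := @seq_uniform_pos R _ [seq x <- sp | sval p x != 0]
  (fun x e => e <= `|sval p x|).
- by move=> x e e' H _ /le_trans; apply.
- by move=> x; rewrite mem_filter => /andP[px _]; exists `|sval p x|; rewrite ?normr_gt0.
exists (Num.min e1 e2) => [|q qA qp]; first by rewrite lt_min e10.
pose t := [seq x <- A | sval q x != 0].
have qt : carried t (sval q) by move=> x qx; rewrite mem_filter qx qA.
apply: (e1P t) qt _.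
- apply/mapP; exists (map_tuple (fun x => sval q x != 0) (in_tuple A)).
    by rewrite mem_enum.
  by rewrite /t filter_mask.
- have [_ _ _ [U WU qU]] := svalP q; exists U => // x.
  by rewrite mem_filter => /andP[qx _]; exact: qU.
- move=> x px; rewrite mem_filter; suff qx : sval q x != 0 by rewrite qx qA.
  apply: contraTneq (qp x) => ->; rewrite sub0r normrN -leNgt.
  by rewrite ge_min (e2P x) ?orbT// mem_filter px spp.
- by move=> x; apply: lt_le_trans (qp x) _; rewrite ge_min lexx.
Qed.

Lemma viet_continuous (T : topologicalType) (h : Viet R W -> T) :
  (forall s p B, simplex W s -> carried s (sval p) -> nbhs (h p) B ->
    exists2 e : R, 0 < e & forall q, carried s (sval q) ->
      (forall x, `|sval q x - sval p x| < e) -> B (h q)) ->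
  continuous h.
Proof.
move=> hP p B; rewrite nbhsE => -[V [oV Vp] VB].
have : nbhs p (h @^-1` V).
  apply: weak_open_nbhs => // s /finite_seqP[t ->] [U WU tU] q Vq qt.
  have [|||e e0 eP] := hP t q V.
  - by exists U.
  - by move=> x /qt.
  - exact: open_nbhs_nbhs.
  by exists e => // q' q't; apply: eP => x /q't.
by apply: filterS => q /VB.
Qed.

(* Since segments are compact, a set whose trace on every [I * simplex] is open
   is open for the product topology (tube lemma). *)
Lemma viet_prod_continuous (T : topologicalType) (h : R * Viet R W -> T) :
  (forall s t p B, simplex W s -> carried s (sval p) -> nbhs (h (t, p)) B ->
    exists2 e : R, 0 < e & forall t' q, `|t' - t| < e -> carried s (sval q) ->
      (forall x, `|sval q x - sval p x| < e) -> B (h (t', q))) ->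
  continuous h.
Proof.
move=> hP [t0 p0] B; rewrite nbhsE => -[V [oV Vp] VB].
have nV t q : V (h (t, q)) -> nbhs (h (t, q)) V by move=> ?; exact: open_nbhs_nbhs.
have [r r0 rV] : exists2 r : R, 0 < r & forall t, `|t - t0| < r -> V (h (t, p0)).
  have [_ _ _ [U WU pU]] := svalP p0; have [s _ sp] := viet_carried p0.
  have [||e e0 eP] := hP [seq x <- s | sval p0 x != 0] t0 p0 V _ _ (nV _ _ Vp).
  - by exists U => // x; rewrite mem_filter => /andP[px _]; exact: pU.
  - by move=> x px; rewrite mem_filter px sp.
  exists e => // t tt; apply: eP => // [x px|x]; first by rewrite mem_filter px sp.
  by rewrite subrr normr0.
pose J := `[t0 - r / 2, t0 + r / 2]%classic.
(* The tube: those [q] whose whole segment over [J] is sent into [V]. Compactness of [J] gives one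
   radius valid for all [t], hence weak openness on each simplex. *)
pose N := [set q | forall t, J t -> V (h (t, q))].
have Np : N p0.
  move=> t; rewrite /J /= in_itv/= => /andP[? ?]; apply: rV.
  by rewrite ltr_norml; apply/andP; split; lra.
have No : viet_weak_open N.
  move=> s /finite_seqP[l ->] [U WU lU] q Nq ql.
  have sl : simplex W l by exists U.
  have cq : carried l (sval q) by move=> x /ql.
  have /compact_near_coveringP cJ : compact J by exact: segment_compact.
  pose P (e t : R) := forall q', carried l (sval q') ->
     (forall x, `|sval q' x - sval q x| < e) -> V (h (t, q')).
  have nearP : forall t, J t -> \forall t' \near t & e \near 0^'+, P e t'.
    move=> t Jt; have [e e0 eP] := hP l t q V sl cq (nV _ _ (Nq t Jt)).
    exists (ball t e, [set x | x < e]); first split => /=.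
    - exact: nbhsx_ballx.
    - exact: nbhs_right_lt.
    move=> [t' e'] [/= tt' e'e] q' q'l q'q; apply: eP => // [|x].
      by move: tt'; rewrite /ball/= distrC.
    exact: lt_trans (q'q x) e'e.
  have nearJ := cJ R _ P (at_right_proper_filter 0) nearP.
  have [e [e0 eP]] : exists e : R, 0 < e /\ J `<=` P e.
    have /filter_ex[e [? ?]] : \forall e \near (0 : R)^'+, 0 < e /\ J `<=` P e.
      by near=> e; split; [|near: e].
    by exists e.
  exists e => // q' q'l q'q t Jt; apply: (eP t Jt) => //.
exists (ball t0 (r / 2), N); first split => /=.
- by apply: nbhsx_ballx; rewrite divr_gt0.
- exact: weak_open_nbhs.
move=> [t q] [/= tt0 Nq]; apply: VB; apply: Nq.
rewrite /J /= in_itv/=; move: tt0; rewrite /ball/= ltr_norml => /andP[? ?].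
by apply/andP; split; lra.
Unshelve. all: by end_near.
Qed.

End VietTopology.

(** * The Wasserstein topology on finitely supported measures *)

Section VietMTopology.
Context {R : realType} {X : choiceType} {W : set (set X)}.
Variable d : X -> X -> R.
Hypothesis dm : is_metric d.
Implicit Types (p q : VietM d W).

Lemma viet_point_carried (f : X -> R) : viet_point W f -> exists s, prob s f.
Proof.
move=> pf; have [_ /finite_carried[s us sp] _ _] := pf.
by exists s; exact: (viet_point_prob pf us).
Qed.

Lemma viet_point_seq (f g h : X -> R) : viet_point W f -> viet_point W g ->
  viet_point W h -> exists s, [/\ prob s f, prob s g & prob s h].
Proof.
move=> pf pg ph; have [_ ff _ _] := pf; have [_ fg _ _] := pg.
have [_ fh _ _] := ph.
have /finite_carried[s us sP] : finite_set (supp f `|` supp g `|` supp h).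
  by rewrite !finite_setU.
by exists s; split; apply: (@viet_point_prob _ _ W) => // x ?; apply: sP;
  [left; left|left; right|right].
Qed.

Lemma wasserstein1_nearby (f g : X -> R) r : viet_point W f -> viet_point W g ->
  wasserstein1 d f g < r -> exists2 c, nearby d c f g & c < r.
Proof.
move=> pf pg; have [s [sf sg _]] := viet_point_seq pf pg pg.
move=> /(wasserstein1_lt_cost sf sg)[p pc pr].
by exists (cost d s p) => //; exists s, p.
Qed.

Lemma nearby_wasserstein1 (f g : X -> R) c : nearby d c f g ->
  wasserstein1 d f g <= c.
Proof.
move=> [s [p [[us sf _ _] [_ sg _ _] pc pcost]]].
exact: le_trans (wasserstein1_le_cost dm us sf sg pc) pcost.
Qed.

Lemma wasserstein1_trans_lt (f g h : X -> R) a b : viet_point W f ->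
  viet_point W g -> viet_point W h ->
  wasserstein1 d f g < a -> wasserstein1 d g h < b -> wasserstein1 d f h < a + b.
Proof.
move=> pf pg ph; have [s [sf sg sh]] := viet_point_seq pf pg ph.
move=> /(wasserstein1_lt_cost sf sg)[p pc pa].
move=> /(wasserstein1_lt_cost sg sh)[q qc qb].
have [w wc wcost] := coupled_glue dm sf sg sh pc qc.
have [us cf _ _] := sf; have [_ ch _ _] := sh.
by have := wasserstein1_le_cost dm us cf ch wc; lra.
Qed.

Lemma nbhs_vietM p e : 0 < e -> nbhs p [set q | wasserstein1 d (sval p) (sval q) < e].
Proof.
move=> e0; rewrite nbhsE; exists [set q | wasserstein1 d (sval p) (sval q) < e] => //.
split; last first.
  have [s sp] := viet_point_carried (svalP p).
  exact: le_lt_trans (nearby_wasserstein1 (nearby_refl dm sp)) e0.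
rewrite /open /=; eexists [set _]; last by rewrite bigcup_set1.
move=> _ ->; apply: (@finI_from1 (set (VietM d W)) _ (@wball R X d W) id).
by exists p, e.
Qed.

(** The subbase consists of balls with arbitrary centres; the triangle inequality recentres each of
    them at [p]. *)
Lemma vietM_nbhs p (B : set (VietM d W)) : nbhs p B ->
  exists2 e : R, 0 < e & forall q, wasserstein1 d (sval p) (sval q) < e -> B q.
Proof.
rewrite nbhsE => -[V [oV Vp] VB]; move: oV; rewrite /open /= => -[D' D'f D'V].
move: Vp; rewrite -D'V => -[A D'A Ap].
have [E Eo EA] := D'f A D'A.
have [||r r0 rP] := @seq_uniform_pos R _ (finmap.enum_fset E)
  (fun U e => forall q : VietM d W, wasserstein1 d (sval p) (sval q) < e -> U q).
- by move=> U e e' UP e'0 e'e q /lt_le_trans/(_ e'e)/UP.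
- move=> U UE; have := Eo U UE.
  rewrite inE => -[p' [e UP]].
  have : U p by move: Ap; rewrite -EA; apply.
  rewrite UP /= => pe; pose c := wasserstein1 d (sval p') (sval p).
  (* Half of the slack [e - c] is spent on making the bound on the distance from [p'] to [p] strict,
     as [wasserstein1_trans_lt] requires. *)
  exists ((e - c) / 2); first by rewrite divr_gt0// subr_gt0.
  move=> q pq /=; have -> : e = (c + (e - c) / 2) + (e - c) / 2 by field.
  apply: wasserstein1_trans_lt (svalP p') (svalP p) (svalP q) _ pq.
  by rewrite -/c; move: pe; rewrite -/c; lra.
exists r => // q pq; apply: VB; rewrite -D'V.
have Aq : A q by rewrite -EA => U UE; exact: rP pq.
by exists A.
Qed.

End VietMTopology.

(** * The deformation *)

Section Schedule.
Context {R : realType}.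
Implicit Types t : R.

Definition clamp (x : R) := Num.max 0 (Num.min 1 x).

Lemma clamp_lip x y : `|clamp x - clamp y| <= `|x - y|.
Proof.
apply: le_trans (max0_lip _ _) _.
have := ler_norm (x - y); have := ler_norm (y - x); rewrite [`|y - x|]distrC.
rewrite ler_norml; case: (leP 1 x) => ?; case: (leP 1 y) => ? ? ?;
  by apply/andP; split; lra.
Qed.

Lemma clamp01 x : 0 <= clamp x <= 1.
Proof. by rewrite le_max lexx ge_max ler01 ge_min lexx. Qed.

Lemma clamp_le0 x : x <= 0 -> clamp x = 0.
Proof. by move=> x0; rewrite /clamp max_l// ge_min x0 orbT. Qed.

Lemma clamp_ge1 x : 1 <= x -> clamp x = 1.
Proof. by move=> x1; rewrite /clamp min_l// max_r. Qed.

(* Coefficients of the three stages of the homotopy: at [t = 1] only the measure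
   itself, at [t = 1/2] only its truncation by [theta], at [t = 0] only the
   discretized measure; the first and the third never mix. *)
Definition keep t := clamp (2 * t - 1).
Definition disc t := clamp (1 - 2 * t).
Definition core t := 1 - keep t - disc t.

(** This is what keeps each intermediate measure inside one simplex: the support of the measure and
    its anchors need not share a member of the cover. *)
Lemma keep_disc t : keep t = 0 \/ disc t = 0.
Proof.
have [t2|t2] := leP (2 * t) 1; [left|right]; apply: clamp_le0; lra.
Qed.

Lemma keep01 t : 0 <= keep t <= 1. Proof. exact: clamp01. Qed.
Lemma disc01 t : 0 <= disc t <= 1. Proof. exact: clamp01. Qed.
Lemma core01 t : 0 <= core t <= 1.
Proof.
rewrite /core; have /andP[? ?] := keep01 t; have /andP[? ?] := disc01 t.
by case: (keep_disc t) => e; move: e; rewrite ?e => e; apply/andP; split; lra.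
Qed.

Lemma keep_lip t t' : `|keep t - keep t'| <= 2 * `|t - t'|.
Proof.
apply: le_trans (clamp_lip _ _) _; rewrite -[2 in leRHS]ger0_norm// -normrM.
by rewrite (_ : _ - _ = 2 * (t - t')) //; ring.
Qed.

Lemma disc_lip t t' : `|disc t - disc t'| <= 2 * `|t - t'|.
Proof.
apply: le_trans (clamp_lip _ _) _; rewrite -[2 in leRHS]ger0_norm// -normrM distrC.
by rewrite (_ : _ - _ = 2 * (t - t')) //; ring.
Qed.

Lemma core_lip t t' : `|core t - core t'| <= 4 * `|t - t'|.
Proof.
have := keep_lip t t'; have := disc_lip t t'; rewrite /core !ler_norml.
by move=> /andP[? ?] /andP[? ?]; apply/andP; split; lra.
Qed.

End Schedule.

Lemma sum_carried_eq {R : realType} {X : choiceType} (s s' : seq X) (F : X -> R) :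
  uniq s -> uniq s' -> carried s F -> carried s' F ->
  \sum_(x <- s) F x = \sum_(x <- s') F x.
Proof. by move=> us us' sF s'F; rewrite -!(fsum_carried _ _ (fun x e => e)). Qed.

Lemma norm_mulB_le {R : realType} (a a' b b' : R) :
  0 <= b <= 1 -> `|a * b - a' * b'| <= `|a - a'| + `|a'| * `|b - b'|.
Proof.
move=> /andP[b0 b1]; have -> : a * b - a' * b' = (a - a') * b + a' * (b - b') by ring.
by rewrite (le_trans (ler_normD _ _))// !normrM lerD// ler_piMr// ger0_norm.
Qed.

(** * Estimates for the deformation, and the homotopy equivalence *)

Section Main.
Context {R : realType} {X : choiceType}.
Variables (d : X -> X -> R) (W : set (set X)) (D : R).
Hypothesis dm : is_metric d.
Hypothesis D0 : 0 < D.
Hypothesis WD : forall U, W U -> forall x y, U x -> U y -> d x y <= D.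
Variables (F : nat -> X -> R) (k : nat -> R) (kappa : X -> R).
Hypothesis F01 : forall j x, 0 <= F j x <= 1.
Hypothesis k01 : forall j, 0 < k j <= 1.
Hypothesis Fk : forall j x y, k j * `|F j x - F j y| <= d x y.
Hypothesis FW : forall j, (exists x, 0 < F j x) ->
  exists2 U, W U & forall x, 0 < F j x -> U x.
Hypothesis Fcov : forall f : X -> R, viet_point W f -> exists j, forall x, f x != 0 -> F j x = 1.
Hypothesis kappa01 : forall x, 0 <= kappa x <= 1.
Hypothesis kappa_fin : forall e : R, 0 < e -> finite_set [set x | e < kappa x].
Hypothesis kappa_dense : forall U, dopen d U -> U !=set0 ->
  exists2 x, U x & 0 < kappa x.
Implicit Types (f g : X -> R) (s : seq X) (t : R).

Let d0 x y : 0 <= d x y. Proof. by case: dm. Qed.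
Let dxx x : d x x = 0. Proof. by case: dm => _ /(_ x x)[_ ->]. Qed.
Let dC x y : d x y = d y x. Proof. by case: dm. Qed.
Let dT y x z : d x z <= d x y + d y z. Proof. by case: dm. Qed.

Local Notation th := (theta F k).
Local Notation anc := (anchor F k kappa).

Let th_lip := @theta_lip R X d F k F01 k01 Fk.
Let anc_lip := @anchor_lip R X d F k dm F01 k01 Fk kappa kappa01.
Let anc_ge0 f x : 0 <= anc f x. Proof. exact: anchor_ge0. Qed.
Let th_ge0 f x : 0 <= th f x. Proof. exact: theta_ge0. Qed.
Let anc_locfin f s := @anchor_locally_finite R X d F k dm F01 k01 Fk kappa
  kappa01 kappa_fin kappa_dense s f.

Lemma theta_in_cover f : viet_point W f ->
  exists2 U, W U & forall x, 0 < th f x -> U x.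
Proof.
move=> pf; have [s ps] := viet_point_carried pf.
have [j Fj] := theta_bump F01 k01 ps.
have [z _ tz] := theta_gt0 F01 k01 ps (Fcov pf).
have [|U WU FU] := FW (j := j); first by exists z; exact: Fj.
by exists U => // x /Fj/FU.
Qed.

Lemma theta_support_point f : viet_point W f -> exists2 z, f z != 0 & 0 < th f z.
Proof.
move=> pf; have [s ps] := viet_point_carried pf; exact: (theta_gt0 F01 k01 ps (Fcov pf)).
Qed.

Lemma anchor_finite f : viet_point W f -> finite_set (supp (anc f)).
Proof.
move=> pf; have [s ps] := viet_point_carried pf.
have [A fA [r r0 rA]] := anc_locfin ps (Fcov pf).
apply: sub_finite_set fA => x /= ax; apply: (rA 0 f) => //.
  exact: (nearby_refl dm ps).
by rewrite lt_neqAle eq_sym ax anc_ge0.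
Qed.

Definition density t f x := keep t + core t * th f x.
(** Unnormalized deformation: [f] at [t = 1], its truncation [theta * f] at [t = 1/2], the anchors
    alone at [t = 0]. Dividing by [mass] gives the measure [blend]. *)
Definition raw t f x := density t f x * f x + disc t * anc f x.
Definition mass t f := \sum_(x \in supp (raw t f)) raw t f x.
Definition blend t f x := raw t f x / mass t f.

Lemma density_ge0 t f x : 0 <= density t f x.
Proof.
rewrite addr_ge0 ?mulr_ge0//; first by case/andP: (keep01 t).
by case/andP: (core01 t).
Qed.

Lemma density_le t s f x : prob s f -> density t f x <= 1 - disc t.
Proof.
move=> pf; have := theta_le1 F01 k01 x pf => t1.
have /andP[c0 c1] := core01 t; have : core t * th f x <= core t by rewrite ler_piMr.
by rewrite /density {2}/core; lra.
Qed.

Lemma density_lip t t' c f g x y : nearby d c f g ->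
  `|density t f x - density t' g y| <= 6 * `|t - t'| + 3 * c + 2 * d x y.
Proof.
move=> fg; have [s [p [pf pg _ _]]] := fg.
rewrite /density opprD addrACA (le_trans (ler_normD _ _))//.
have := keep_lip t t'; have := core_lip t t'; have := th_lip x y fg.
have : `|core t * th f x - core t' * th g y| <=
  `|core t - core t'| + `|core t'| * `|th f x - th g y|.
  by apply: norm_mulB_le; rewrite th_ge0 (theta_le1 F01 k01 x pf).
have : `|core t'| * `|th f x - th g y| <= `|th f x - th g y|.
  by have /andP[? ?] := core01 t'; rewrite ler_piMl// ger0_norm.
lra.
Qed.

Lemma disc_anchor_lip t t' c f g x : nearby d c f g ->
  `|disc t * anc f x - disc t' * anc g x| <= 2 * `|t - t'| + 5 * c.
Proof.
move=> fg; have [s [p [pf pg _ _]]] := fg.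
apply: le_trans (norm_mulB_le _ _ _ _) _.
  rewrite anc_ge0/=; rewrite ge_max ler01/=.
  have kt1 y := ktheta_le1 F01 k01 kappa01 y pf.
  have := kt1 x; have := rsup_ge x kt1; rewrite -/(peak F k kappa f).
  have : 0 <= kappa x * th f x by rewrite mulr_ge0//; case/andP: (kappa01 x).
  lra.
have := disc_lip t t'; have := anc_lip x fg.
have : `|disc t'| * `|anc f x - anc g x| <= `|anc f x - anc g x|.
  by have /andP[? ?] := disc01 t'; rewrite ler_piMl// ger0_norm.
lra.
Qed.

Lemma raw_ge0 t f x : viet_point W f -> 0 <= raw t f x.
Proof.
move=> [f0 _ _ _]; rewrite addr_ge0 ?mulr_ge0 ?density_ge0//.
by case/andP: (disc01 t).
Qed.

Lemma raw_support t f x : raw t f x != 0 -> f x != 0 \/ anc f x != 0.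
Proof.
rewrite /raw; have [->|] := eqVneq (f x) 0; last by left.
by rewrite mulr0 add0r mulf_eq0 negb_or => /andP[_]; right.
Qed.

Lemma carried_raw t s f : carried s f -> carried s (anc f) -> carried s (raw t f).
Proof. by move=> sf sa x /raw_support[/sf|/sa]. Qed.

Lemma supports_carried f : viet_point W f ->
  exists s, [/\ uniq s, carried s f & carried s (anc f)].
Proof.
move=> pf; have [_ ff _ _] := pf; have fa := anchor_finite pf.
have /finite_carried[s us sP] : finite_set (supp f `|` supp (anc f)).
  by rewrite finite_setU.
by exists s; split=> // x ?; apply: sP; [left|right].
Qed.

Lemma mass_carried t s f : uniq s -> carried s f -> carried s (anc f) ->
  mass t f = \sum_(x <- s) raw t f x.
Proof. by move=> us sf sa; rewrite /mass (fsum_carried us)//; exact: carried_raw. Qed.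

Lemma raw_le_mass t f x : viet_point W f -> raw t f x <= mass t f.
Proof.
move=> pf; have [s [us sf sa]] := supports_carried pf.
rewrite (mass_carried t us sf sa).
have [xs|xs] := boolP (x \in s).
  rewrite (bigD1_seq x)//= lerDl; apply: sumr_ge0 => y _; exact: raw_ge0.
rewrite (carried_out (carried_raw (t := t) sf sa) xs).
by apply: sumr_ge0 => y _; exact: raw_ge0.
Qed.

(** If [disc t] is nonzero, some anchor contributes. Otherwise [keep t + core t = 1], and a support
    point with positive [theta] contributes. *)
Lemma mass_gt0 t f : viet_point W f -> 0 < mass t f.
Proof.
move=> pf; have [s ps] := viet_point_carried pf; have [f0 _ _ _] := pf.
suff [x rx] : exists x, 0 < raw t f x by exact: lt_le_trans rx (raw_le_mass _ _ pf).
have [td|td] := eqVneq (disc t) 0; last first.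
  have [x ax] := anchor_gt0 dm F01 k01 Fk kappa01 kappa_dense ps (Fcov pf).
  exists x; rewrite ltr_wpDl ?mulr_ge0 ?density_ge0// mulr_gt0//.
  by rewrite lt_neqAle eq_sym td; case/andP: (disc01 t).
have [z fz tz] := theta_support_point pf; exists z.
rewrite /raw td mul0r addr0 mulr_gt0//; last by rewrite lt_neqAle eq_sym fz f0.
have /andP[c0 c1] := core01 t; have /andP[k0 k1] := keep01 t.
have [k00|kp] := eqVneq (keep t) 0.
  by rewrite /density /core k00 td add0r !subr0 mul1r.
rewrite ltr_pwDl ?mulr_ge0//.
by rewrite lt_neqAle eq_sym kp.
Qed.

(** The density part is an integral, controlled by the coupling; the anchor part is a sum over the
    finite list [A] common to [f] and [g]. These account for the [(size A).+1] terms. *)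
Lemma mass_lip t t' c f g (A : seq X) : viet_point W f -> viet_point W g ->
  nearby d c f g -> uniq A -> carried A (anc f) -> carried A (anc g) ->
  `|mass t f - mass t' g| <= (size A).+1%:R * (6 * `|t - t'| + 5 * c).
Proof.
move=> pf pg fg uA Af Ag.
have massE t0 h : viet_point W h -> carried A (anc h) ->
    mass t0 h = mean h (density t0 h) + \sum_(x <- A) disc t0 * anc h x.
  move=> ph Ah; have [s [us sh sa]] := supports_carried ph.
  rewrite (mass_carried _ us sh sa) (mean_carried _ us sh) big_split/=.
  congr (_ + _); first by apply: eq_bigr => x _; rewrite mulrC.
  by apply: sum_carried_eq => // x; rewrite mulf_eq0 negb_or => /andP[_ ?]; auto.
rewrite (massE t f)// (massE t' g)// opprD addrACA -sumrB.
apply: le_trans (ler_normD _ _) _.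
have := mean_nearby fg (ler0n _ 2) (fun x y => density_lip t t' x y fg).
have H : `|\sum_(x <- A) (disc t * anc f x - disc t' * anc g x)| <=
    (size A)%:R * (6 * `|t - t'| + 5 * c).
  apply: le_trans (ler_norm_sum _ _ _) _.
  apply: (@le_trans _ _ (\sum_(x <- A) (6 * `|t - t'| + 5 * c))).
    apply: ler_sum => x _; apply: le_trans (disc_anchor_lip t t' x fg) _.
    by have := normr_ge0 (t - t'); lra.
  by rewrite big_const_seq iter_addr_0 count_predT [leRHS]mulr_natl.
by move: H; rewrite -natr1 mulrDl mul1r; lra.
Qed.

Lemma blend_ge0 t f x : viet_point W f -> 0 <= blend t f x.
Proof. by move=> pf; rewrite divr_ge0 ?raw_ge0 ?ltW ?mass_gt0. Qed.

Lemma blend_support t f x : viet_point W f ->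
  (blend t f x != 0) = (raw t f x != 0).
Proof.
by move=> pf; rewrite mulf_eq0 invr_eq0 (gt_eqF (mass_gt0 t pf)) orbF.
Qed.

Lemma blend_sum t s f : viet_point W f -> uniq s -> carried s f ->
  carried s (anc f) -> \sum_(x <- s) blend t f x = 1.
Proof.
move=> pf us sf sa; rewrite -mulr_suml -(mass_carried t us sf sa) divff//.
by rewrite gt_eqF// mass_gt0.
Qed.

Lemma blend_viet_point t f : viet_point W f -> viet_point W (blend t f).
Proof.
move=> pf; have [s ps] := viet_point_carried pf; have [s' [us sf sa]] := supports_carried pf.
have [f0 _ _ [U WU fU]] := pf.
have sb : carried s' (blend t f).
  by move=> x; rewrite blend_support//; exact: carried_raw.
split.
- by move=> x; exact: blend_ge0.
- by apply: (sub_finite_set _ (finite_seq s')) => x /sb.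
- by rewrite (fsum_carried us sb)// blend_sum.
(* Without anchors the support lies in that of [f]; without [keep] it lies in the positivity set of
   [theta]. Each is inside one member of the cover. *)
case: (keep_disc t) => td; last first.
  exists U => // x; rewrite /supp/= blend_support// /raw td mul0r addr0.
  by rewrite mulf_eq0 negb_or => /andP[_ /fU].
have [V WV thV] := theta_in_cover pf; exists V => // x.
rewrite /supp/= blend_support// => rx; apply: thV.
have [ax|ax] := eqVneq (anc f x) 0; last first.
  apply: (anchor_theta F01 k01 kappa01 ps).
  by rewrite lt_neqAle eq_sym ax anc_ge0.
rewrite lt_neqAle th_ge0 andbT eq_sym; apply: contraNneq rx => tx.
by rewrite /raw /density ax td tx !(mulr0,mul0r,addr0).
Qed.

Lemma blend1 f : viet_point W f -> blend 1 f = f.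
Proof.
move=> pf; have [s [us sf sa]] := supports_carried pf.
have [_ _ _ f1] := viet_point_prob pf us sf.
have rawE x : raw 1 f x = f x.
  rewrite /raw /density /core /keep /disc (@clamp_ge1 _ (2 * 1 - 1)); last by lra.
  rewrite (@clamp_le0 _ (1 - 2 * 1)); last by lra.
  by rewrite subrr subr0 !mul0r !addr0 mul1r.
apply/funext => x; rewrite /blend (mass_carried 1 us sf sa) rawE.
by under eq_bigr do rewrite rawE; rewrite f1 divr1.
Qed.


Lemma prob_le1 s f x : prob s f -> f x <= 1.
Proof.
move=> [us sf f0 f1]; have [xs|xs] := boolP (x \in s); last first.
  by rewrite (carried_out sf xs).
by rewrite -f1 (bigD1_seq x)//= lerDl sumr_ge0.
Qed.

(** The factor [1 - disc t] matters: Wasserstein closeness does not make [f x] close to [g x], and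
    at [t = 0] this term disappears. *)
Lemma raw_lip t t' c f g x : nearby d c f g ->
  `|raw t f x - raw t' g x| <=
  (1 - disc t) * `|f x - g x| + 8 * `|t - t'| + 8 * c.
Proof.
move=> fg; have [s [p [pf pg _ _]]] := fg.
have g01 : 0 <= g x <= 1 by rewrite (prob_le1 _ pg) andbT; case: pg.
have := disc_anchor_lip t t' x fg; have := density_lip t t' x x fg.
rewrite dxx mulr0 addr0 => H1 H2.
have -> : raw t f x - raw t' g x = density t f x * (f x - g x) +
  (density t f x - density t' g x) * g x + (disc t * anc f x - disc t' * anc g x).
  by rewrite /raw; ring.
apply: le_trans (ler_normD _ _) _.
have : `|density t f x * (f x - g x)| <= (1 - disc t) * `|f x - g x|.
  by rewrite normrM ler_wpM2r// ger0_norm ?density_ge0// (density_le _ _ pf).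
have : `|(density t f x - density t' g x) * g x| <= 6 * `|t - t'| + 3 * c.
  apply: le_trans H1; have /andP[? ?] := g01.
  by rewrite normrM ler_piMr// ger0_norm.
have := ler_normD (density t f x * (f x - g x))
  ((density t f x - density t' g x) * g x).
lra.
Qed.

Lemma blend_lip t t' c f g (A : seq X) x : viet_point W f -> viet_point W g ->
  nearby d c f g -> uniq A -> carried A (anc f) -> carried A (anc g) ->
  `|blend t f x - blend t' g x| <=
  ((1 - disc t) * `|f x - g x| +
    (size A).+2%:R * (8 * `|t - t'| + 8 * c)) / mass t f.
Proof.
move=> pf pg fg uA Af Ag.
have c0 := nearby_ge0 dm fg.
have N0 := mass_gt0 t pf; have N'0 := mass_gt0 t' pg.
have := mass_lip t t' pf pg fg uA Af Ag.
have := raw_lip t t' x fg.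
rewrite /blend; set N := mass t f in N0 *; set N' := mass t' g in N'0 *.
set h := raw t f x; set h' := raw t' g x => H1 H2.
have h'0 : 0 <= h' by exact: raw_ge0.
have h'N : h' <= N' by exact: raw_le_mass.
(* Since [h' / N'] is at most 1, only the mass [N] of the fixed point [f] remains in the
   denominator. *)
have -> : h / N - h' / N' = ((h - h') + h' / N' * (N' - N)) / N.
  by field; rewrite !gt_eqF.
rewrite normrM normfV [`|N|]gtr0_norm// ler_pM2r ?invr_gt0//.
apply: le_trans (ler_normD _ _) _.
have : `|h' / N' * (N' - N)| <= `|N - N'|.
  have hN1 : h' / N' <= 1 by rewrite ler_pdivrMr// mul1r.
  have hN0 : 0 <= h' / N' by rewrite divr_ge0// ltW.
  by rewrite normrM (ger0_norm hN0) distrC ler_piMl.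
have : (size A).+1%:R * (6 * `|t - t'| + 5 * c) <=
    (size A).+1%:R * (8 * `|t - t'| + 8 * c).
  by rewrite ler_wpM2l//; have := normr_ge0 (t - t'); lra.
have -> : (size A).+2%:R * (8 * `|t - t'| + 8 * c) =
    (size A).+1%:R * (8 * `|t - t'| + 8 * c) + (8 * `|t - t'| + 8 * c).
  by rewrite -[(size A).+2%:R]natr1 mulrDl mul1r.
by move: H1 H2; lra.
Qed.

(** The support of [f] and the positivity set of [theta] each have diameter at most [D] and share
    the point [y]. *)
Lemma raw_spread t f x z : viet_point W f -> raw t f x != 0 -> f z != 0 ->
  d x z <= 2 * D.
Proof.
move=> pf rx fz; have [y fy ty] := theta_support_point pf.
have [_ _ _ [U WU fU]] := pf; have [V WV thV] := theta_in_cover pf.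
have [s ps] := viet_point_carried pf.
have := dT y x z; have := WD WU (fU _ fy) (fU _ fz).
suff : d x y <= D by lra.
case: (raw_support rx) => [fx|ax]; first exact: (WD WU (fU _ fx) (fU _ fy)).
apply: (WD WV) (thV _ ty); apply: thV; apply: (anchor_theta F01 k01 kappa01 ps).
by rewrite lt_neqAle eq_sym ax anc_ge0.
Qed.

(** If all coupled pairs were at distance at least [c + 1], so would be their average, the cost. *)
Lemma nearby_points c f g : nearby d c f g ->
  exists x y, [/\ f x != 0, g y != 0 & d x y <= c + 1].
Proof.
move=> [s [p [pf pg pc pcost]]]; apply: contrapT => no.
have [p0 pfg p1 p2] := pc.
have : c + 1 <= cost d s p.
  have := coupled_affine d (c + 1) 0 pf pc; rewrite mul0r addr0 => <-.
  apply: ler_sum => x _; apply: ler_sum => y _; rewrite mul0r addr0.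
  have [->|/pfg[fx gy]] := eqVneq (p x y) 0; first by rewrite !mul0r.
  rewrite ler_wpM2l// leNgt; apply/negP => /ltW dxy.
  by apply: no; exists x, y.
by move: pcost; lra.
Qed.

(* Transport the part [density * f] along a coupling of [f] and [g], leave the
   common part of the anchors in place, and move the remaining small mass
   arbitrarily, which costs little since everything lies at bounded distance. *)
Lemma blend_wasserstein t t' c f g (A : seq X) : viet_point W f ->
  viet_point W g -> nearby d c f g -> c <= 1 ->
  uniq A -> carried A (anc f) -> carried A (anc g) ->
  wasserstein1 d (blend t f) (blend t' g) <=
  (c + (4 * D + 2) * ((size A).+1%:R * (6 * `|t - t'| + 5 * c))) / mass t f.
Proof.
move=> pf pg fg c1 uA Af Ag.
have c0 := nearby_ge0 dm fg.
have N0 := mass_gt0 t pf; have N'0 := mass_gt0 t' pg.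
have [s1 [_ s1f s1a]] := supports_carried pf; have [s2 [_ s2g s2a]] := supports_carried pg.
pose s := undup (s1 ++ s2 ++ A).
have us : uniq s by exact: undup_uniq.
have sf : carried s f by move=> x /s1f xs; rewrite mem_undup !mem_cat xs.
have sa : carried s (anc f) by move=> x /s1a xs; rewrite mem_undup !mem_cat xs.
have sg : carried s g by move=> x /s2g xs; rewrite mem_undup !mem_cat xs orbT.
have sb : carried s (anc g) by move=> x /s2a xs; rewrite mem_undup !mem_cat xs orbT.
have [p [Pf Pg pc pcost]] := nearby_carried fg us sf sg.
have [p0 pfg p1 p2] := pc.
pose w x := density t f x; pose w' x := density t' g x.
pose v x := disc t * anc f x; pose v' x := disc t' * anc g x.
have w0 x : 0 <= w x by exact: density_ge0.
have w'0 x : 0 <= w' x by exact: density_ge0.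
have v0 x : 0 <= v x by rewrite mulr_ge0//; case/andP: (disc01 t).
have v'0 x : 0 <= v' x by rewrite mulr_ge0//; case/andP: (disc01 t').
pose pw x y := Num.min (w x) (w' y) * p x y.
pose mv x := Num.min (v x) (v' x).
have mv0 x : 0 <= mv x by rewrite le_min v0 v'0.
pose diag x y := if x == y then mv x else 0.
have mvs x : x \notin s -> mv x = 0.
  by move=> xs; rewrite /mv /v (carried_out sa xs) mulr0 min_l.
have pw0 x y : 0 <= pw x y by rewrite mulr_ge0// le_min w0 w'0.
have diag0 x y : 0 <= diag x y by rewrite /diag; case: ifP.
pose q x y := pw x y + diag x y.
have q0 x y : 0 <= q x y by rewrite addr_ge0.
have sumdiag x : \sum_(y <- s) diag x y = mv x.
  exact: (sum_diag us (@mvs x)).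
have sumdiag' y : \sum_(x <- s) diag x y = mv y.
  rewrite -[RHS]sumdiag; apply: eq_bigr => x _.
  by rewrite /diag eq_sym; case: eqP => // ->.
set N := mass t f in N0 *; set N' := mass t' g in N'0 *.
have NE : N = \sum_(x <- s) raw t f x by exact: mass_carried.
have N'E : N' = \sum_(x <- s) raw t' g x by exact: mass_carried.
pose Q := \sum_(x <- s) \sum_(y <- s) q x y.
pose Dl := (size A).+1%:R * (6 * `|t - t'| + 5 * c).
(* [Dl] bounds the mass lost by taking minima, both of the densities along [p] and of the anchor
   weights on [A]. *)
have Dle : \sum_(x <- s) \sum_(y <- s) p x y * `|w x - w' y| +
    \sum_(x <- s) `|v x - v' x| <= Dl.
  have H1 : \sum_(x <- s) \sum_(y <- s) p x y * `|w x - w' y| <=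
      6 * `|t - t'| + 5 * c.
    apply: (@le_trans _ _ (\sum_(x <- s) \sum_(y <- s)
        p x y * ((6 * `|t - t'| + 3 * c) + 2 * d x y))).
      apply: ler_sum => x _; apply: ler_sum => y _.
      by rewrite ler_wpM2l// density_lip.
    by rewrite (coupled_affine _ _ _ Pf pc); move: pcost; lra.
  have H2 : \sum_(x <- s) `|v x - v' x| <= (size A)%:R * (6 * `|t - t'| + 5 * c).
    rewrite (@sum_carried_eq _ _ s A)//; first last.
    - move=> x; rewrite normr_eq0 /v /v' => vx.
      have [ax|/Af//] := eqVneq (anc f x) 0.
      have [bx|/Ag//] := eqVneq (anc g x) 0.
      by move: vx; rewrite ax bx !mulr0 subrr eqxx.
    - move=> x; rewrite normr_eq0 /v /v' => vx.
      have [ax|/sa//] := eqVneq (anc f x) 0.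
      have [bx|/sb//] := eqVneq (anc g x) 0.
      by move: vx; rewrite ax bx !mulr0 subrr eqxx.
    apply: (@le_trans _ _ (\sum_(x <- A) (6 * `|t - t'| + 5 * c))).
      apply: ler_sum => x _; apply: le_trans (disc_anchor_lip t t' x fg) _.
      by have := normr_ge0 (t - t'); lra.
    by rewrite big_const_seq iter_addr_0 count_predT [leRHS]mulr_natl.
  by rewrite /Dl -natr1 mulrDl mul1r; lra.
have NQ : N - Q <= Dl.
  apply: le_trans Dle; rewrite NE /Q -sumrB -big_split/=.
  apply: ler_sum => x _; rewrite big_split/= sumdiag.
  have -> : raw t f x - (\sum_(y <- s) pw x y + mv x) =
      \sum_(y <- s) (w x * p x y - pw x y) + (v x - mv x).
    by rewrite sumrB -mulr_sumr p1 /raw -/(w x) -/(v x); ring.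
  rewrite lerD//; last by rewrite /mv; case: (leP (v x) (v' x)) => ?; rewrite ?subrr// ler_norm.
  apply: ler_sum => y _; rewrite /pw -mulrBl mulrC ler_wpM2l//.
  by case: (leP (w x) (w' y)) => ?; rewrite ?subrr// ler_norm.
have N'Q : N' - Q <= Dl.
  apply: le_trans Dle; rewrite N'E /Q [X in _ - X]exchange_big/=.
  rewrite [X in _ <= X + _]exchange_big/= -sumrB -big_split/=.
  apply: ler_sum => y _; rewrite big_split/= sumdiag'.
  have -> : raw t' g y - (\sum_(x <- s) pw x y + mv y) =
      \sum_(x <- s) (w' y * p x y - pw x y) + (v' y - mv y).
    by rewrite sumrB -mulr_sumr p2 /raw -/(w' y) -/(v' y); ring.
  rewrite lerD//; last first.
    by rewrite /mv distrC; case: (leP (v y) (v' y)) => ?; rewrite ?subrr// ler_norm.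
  apply: ler_sum => x _; rewrite /pw -mulrBl mulrC ler_wpM2l// distrC.
  by case: (leP (w x) (w' y)) => ?; rewrite ?subrr// ler_norm.
(* Dividing [q] by the larger mass puts its marginals below both normalized measures, and the
   unmatched part [m - Q] is still at most [Dl]. *)
pose m := Num.max N N'.
have m0 : 0 < m by rewrite lt_max N0.
have Nm : N <= m by rewrite le_max lexx.
have N'm : N' <= m by rewrite le_max lexx orbT.
have Pb : prob s (blend t f).
  split=> //; [|by move=> x; exact: blend_ge0|exact: blend_sum].
  by move=> x; rewrite blend_support//; exact: carried_raw.
have Pb' : prob s (blend t' g).
  split=> //; [|by move=> x; exact: blend_ge0|exact: blend_sum].
  by move=> x; rewrite blend_support//; exact: carried_raw.
(* The constant [4 * D + 2] is the length of a path through support points [x0] of [f] and [y0] of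
   [g]: [2 * D] on either side and [c + 1 <= 2] between them. *)
have [||||| u uc ucost] := @coupled_complete R X d s (blend t f) (blend t' g)
    (fun x y => q x y / m) (4 * D + 2) Pb Pb'.
- by move=> x y; rewrite divr_ge0// ltW.
- move=> x y; rewrite mulf_eq0 negb_or => /andP[+ _].
  have [pxy|/pfg[/sf ? /sg ?] _ //] := eqVneq (p x y) 0.
  rewrite /q /pw pxy mulr0 add0r /diag; case: (x =P y) => [<-|_]; last by rewrite eqxx.
  by move=> mx; have : x \in s by apply: contraNT mx => /mvs ->.
- move=> x; rewrite -mulr_suml big_split/= sumdiag.
  apply: (@le_trans _ _ (raw t f x / m)).
    rewrite ler_pM2r ?invr_gt0// lerD//; last by rewrite ge_min lexx.
    rewrite -(p1 x) mulr_sumr; apply: ler_sum => y _.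
    by rewrite ler_wpM2r// ge_min lexx.
  apply: ler_wpM2l; first exact: raw_ge0.
  by rewrite lef_pV2 ?posrE.
- move=> y; rewrite -mulr_suml big_split/= sumdiag'.
  apply: (@le_trans _ _ (raw t' g y / m)).
    rewrite ler_pM2r ?invr_gt0// lerD//; last by rewrite ge_min lexx orbT.
    rewrite -(p2 y) mulr_sumr; apply: ler_sum => x _.
    by rewrite ler_wpM2r// ge_min lexx orbT.
  apply: ler_wpM2l; first exact: raw_ge0.
  by rewrite lef_pV2 ?posrE.
- move=> x y; rewrite !blend_support// => rx ry.
  have [x0 [y0 [fx0 gy0 dx0y0]]] := nearby_points fg.
  have := raw_spread pf rx fx0; have := raw_spread pg ry gy0.
  have := dT x0 x y; have := dT y0 x0 y; rewrite (dC y0 y); lra.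
have [_ cb _ _] := Pb; have [_ cb' _ _] := Pb'.
apply: le_trans (wasserstein1_le_cost dm us cb cb' uc) _.
apply: le_trans ucost _.
have -> : cost d s (fun x y => q x y / m) = cost d s q / m.
  rewrite /cost mulr_suml; apply: eq_bigr => x _.
  by rewrite mulr_suml; apply: eq_bigr => y _; rewrite mulrAC.
have -> : \sum_(x <- s) \sum_(y <- s) q x y / m = Q / m.
  by rewrite /Q mulr_suml; apply: eq_bigr => x _; rewrite mulr_suml.
have qcost : cost d s q <= c.
  apply: le_trans pcost; apply: ler_sum => x _; apply: ler_sum => y _.
  rewrite /q mulrDl [diag x y * d x y](_ : _ = 0) ?addr0; last first.
    by rewrite /diag; case: eqP => [->|_]; rewrite ?dxx ?mulr0 ?mul0r.
  rewrite ler_wpM2r// /pw ler_piMl// ge_min; apply/orP; left.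
  have := density_le t x Pf; rewrite -/(w x); have /andP[? _] := disc01 t; lra.
have Dl0 : 0 <= Dl.
  by rewrite mulr_ge0// addr_ge0// mulr_ge0.
have mQ : m - Q <= Dl by rewrite /m; case: (leP N N').
apply: (@le_trans _ _ ((c + (4 * D + 2) * Dl) / m)).
  have -> : cost d s q / m + (4 * D + 2) * (1 - Q / m) =
      (cost d s q + (4 * D + 2) * (m - Q)) / m by field; rewrite gt_eqF.
  rewrite ler_pM2r ?invr_gt0// lerD// ler_wpM2l//.
  by move: D0; lra.
apply: ler_wpM2l; last by rewrite lef_pV2 ?posrE.
by rewrite addr_ge0// mulr_ge0//; move: D0; lra.
Qed.


(** The common part [min f g] stays in place; the rest has mass at most [size s * r] and moves by at
    most [D], as [s] lies in one member of the cover. *)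
Lemma simplex_nearby s f g r : simplex W s -> uniq s -> viet_point W f ->
  viet_point W g -> carried s f -> carried s g ->
  (forall x, `|g x - f x| <= r) -> nearby d (D * (size s)%:R * r) f g.
Proof.
move=> [U WU sU] us pf pg sf sg fg.
have Pf := viet_point_prob pf us sf; have Pg := viet_point_prob pg us sg.
have [f0 _ _ _] := pf; have [g0 _ _ _] := pg.
pose m x := Num.min (f x) (g x).
have m0 x : 0 <= m x by rewrite le_min f0 g0.
have ms x : x \notin s -> m x = 0.
  by move=> xs; rewrite /m (carried_out sf xs) (carried_out sg xs) minxx.
pose q x y := if x == y then m x else 0.
have sumq x : \sum_(y <- s) q x y = m x by exact: (sum_diag us (@ms x)).
have sumq' y : \sum_(x <- s) q x y = m y.
  rewrite -[RHS]sumq; apply: eq_bigr => x _.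
  by rewrite /q eq_sym; case: (y =P x) => // ->.
have [|||||u uc ucost] := @coupled_complete R X d s f g q D Pf Pg.
- by move=> x y; rewrite /q; case: ifP.
- move=> x y; rewrite /q; case: (x =P y) => [<-|_]; last by rewrite eqxx.
  by move=> mx; have : x \in s by apply: contraNT mx => /ms ->.
- by move=> x; rewrite sumq ge_min lexx.
- by move=> x; rewrite sumq' ge_min lexx orbT.
- by move=> x y /sf/sU Ux /sg/sU Uy; exact: (WD WU).
exists s, u; split=> //; apply: le_trans ucost _.
have -> : cost d s q = 0.
  rewrite /cost big1// => x _; rewrite big1// => y _.
  by rewrite /q; case: (x =P y) => [->|_]; rewrite ?dxx ?mulr0 ?mul0r.
rewrite add0r -mulrA; apply: ler_wpM2l; first exact: ltW.
under eq_bigr do rewrite sumq.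
have [_ _ _ f1] := Pf; rewrite -[X in X - _]f1 -sumrB.
apply: (@le_trans _ _ (\sum_(x <- s) r)); last first.
  by rewrite big_const_seq iter_addr_0 count_predT [leRHS]mulr_natl.
apply: ler_sum => x _; apply: le_trans (fg x).
rewrite /m distrC; case: (leP (f x) (g x)) => _; last exact: ler_norm.
by rewrite subrr.
Qed.

Lemma exists_small (K r e : R) : 0 <= K -> 0 < r -> 0 < e ->
  exists2 h, 0 < h & h <= r /\ K * h < e.
Proof.
move=> K0 r0 e0; have K1 : 0 < K + 1 by lra.
(* [K + 1] instead of [K], because [K] may be 0. *)
exists (Num.min r (e / (K + 1))); first by rewrite lt_min r0 divr_gt0.
split; first by rewrite ge_min lexx.
apply: (@le_lt_trans _ _ (K * (e / (K + 1)))).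
  by rewrite ler_wpM2l// ge_min lexx orbT.
by rewrite mulrCA -[ltRHS]mulr1 ltr_pM2l// ltr_pdivrMr// mul1r ltrDl.
Qed.

Lemma anchor_local_seq f : viet_point W f -> exists A : seq X,
  [/\ uniq A, carried A (anc f) & exists2 r : R, 0 < r &
    forall c g, c < r -> nearby d c f g -> carried A (anc g)].
Proof.
move=> pf; have [s ps] := viet_point_carried pf.
have [A' /finite_carried[A uA A'A] [r r0 rA]] := anc_locfin ps (Fcov pf).
have near_carried c g : c < r -> nearby d c f g -> carried A (anc g).
  move=> cr fg x ax; apply: A'A; apply: (rA c g x cr fg).
  by rewrite lt_neqAle eq_sym ax anc_ge0.
exists A; split=> //; last by exists r.
exact: near_carried r0 (nearby_refl dm ps).
Qed.

Lemma disc0 : disc 0 = 1 :> R.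
Proof. by rewrite /disc clamp_ge1//; lra. Qed.

Lemma density0 f x : density 0 f x = 0.
Proof.
by rewrite /density /core disc0 /keep clamp_le0 ?subr0 ?subrr ?mul0r ?addr0.
Qed.

Definition blend_point (tp : R * viet_pts R W) : viet_pts R W :=
  exist _ (blend tp.1 (sval tp.2)) (blend_viet_point tp.1 (svalP tp.2)).

(** Near [p] all anchors lie in one finite list [A], where weak neighbourhoods are detected by
    pointwise closeness; [blend_lip] provides it, its term in [f x - g x] being absent at
    [t = 0]. *)
Lemma discretize_continuous :
  continuous (fun q : VietM d W => blend_point (0, q) : Viet R W).
Proof.
move=> p B /nbhs_weak_open[V [oV Vp VB]].
have [A [uA Ap [r r0 rA]]] := anchor_local_seq (svalP p).
have [e e0 eP] := weak_open_carried A oV Vp.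
have N0 := mass_gt0 0 (svalP p).
have [|||h h0 [hr hK]] := @exists_small ((size A).+2%:R * 8) r (e * mass 0 (sval p)).
- by rewrite mulr_ge0.
- by [].
- exact: mulr_gt0.
have : nbhs p [set q : VietM d W | wasserstein1 d (sval p) (sval q) < h].
  exact: nbhs_vietM.
apply: filterS => q /= /(wasserstein1_nearby (svalP p) (svalP q))[c pq ch].
apply: VB; apply: eP => [x|x] /=.
  have Aq := rA c _ (lt_le_trans ch hr) pq.
  rewrite blend_support; last exact: svalP.
  rewrite /raw density0 mul0r add0r mulf_eq0 negb_or => /andP[_ /Aq].
  by [].
rewrite distrC; apply: le_lt_trans
  (blend_lip 0 0 x (svalP p) (svalP q) pq uA Ap (rA c _ (lt_le_trans ch hr) pq)) _.
rewrite disc0 !subrr mul0r add0r normr0 mulr0 add0r ltr_pdivrMr// mulrA.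
by apply: le_lt_trans hK; rewrite ler_wpM2l// ltW.
Qed.

(** On a fixed simplex, pointwise closeness gives both terms of [blend_lip], through
    [simplex_nearby] for the Wasserstein part; the images are carried by the finite list
    [s ++ A]. *)
Lemma viet_homotopy_continuous :
  continuous (blend_point : R * Viet R W -> Viet R W).
Proof.
apply: viet_prod_continuous => s t p B ss sp /nbhs_weak_open[V [oV Vp VB]].
have [A [uA Ap [r r0 rA]]] := anchor_local_seq (svalP p).
have [e e0 eP] := weak_open_carried (s ++ A) oV Vp.
have N0 := mass_gt0 t (svalP p).
pose u := undup s; pose M := D * (size u)%:R; pose a : R := (size A).+2%:R.
have M0 : 0 <= M by rewrite mulr_ge0// ltW.
have a0 : 0 <= a by [].
have aM0 : 0 <= a * M by exact: mulr_ge0.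
(* The first three terms collect the bound of [blend_lip]; the final [M] ensures [M * h < r], so
   that the anchors of [q] stay in [A]. *)
have [|||h h0 [_ hK]] := @exists_small (1 + a * 8 + a * M * 8 + M) 1
  (Num.min r (e * mass t (sval p))).
- by lra.
- by [].
- by rewrite lt_min r0 mulr_gt0.
move: hK; rewrite lt_min => /andP[hr he].
exists h => // t' q tt' sq pq; apply: VB.
have near_pq : nearby d (M * h) (sval p) (sval q).
  apply: simplex_nearby.
  - by have [U WU sU] := ss; exists U => // x; rewrite mem_undup; exact: sU.
  - exact: undup_uniq.
  - exact: svalP.
  - exact: svalP.
  - by move=> x /sp; rewrite mem_undup.
  - by move=> x /sq; rewrite mem_undup.
  - by move=> x; exact: ltW.
have Mh : M * h < r.
  apply: le_lt_trans hr; apply: ler_wpM2r; first exact: ltW.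
  by lra.
have Aq := rA _ _ Mh near_pq.
apply: eP => [x|x] /=.
  rewrite blend_support; last exact: svalP.
  by rewrite mem_cat => /raw_support[/sq ->//|/Aq ->]; rewrite orbT.
rewrite distrC; apply: le_lt_trans
  (blend_lip t t' x (svalP p) (svalP q) near_pq uA Ap Aq) _.
rewrite ltr_pdivrMr//; apply: le_lt_trans he.
have H1 : (1 - disc t) * `|sval p x - sval q x| <= h.
  apply: (@le_trans _ _ `|sval p x - sval q x|); last by rewrite distrC ltW.
  by have /andP[? ?] := disc01 t; rewrite ler_piMl//; lra.
have H2 : a * (8 * `|t - t'| + 8 * (M * h)) <= a * (8 * h + 8 * (M * h)).
  by rewrite ler_wpM2l// lerD2r ler_wpM2l// distrC ltW.
have : 0 <= M * h by rewrite mulr_ge0// ltW.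
have -> : (1 + a * 8 + a * M * 8 + M) * h =
  h + a * (8 * h + 8 * (M * h)) + M * h by ring.
by move: H1 H2; rewrite /a; lra.
Qed.

Lemma vietM_homotopy_continuous :
  continuous (blend_point : R * VietM d W -> VietM d W).
Proof.
move=> [t p] B /(vietM_nbhs dm)[e e0 eP].
have [A [uA Ap [r r0 rA]]] := anchor_local_seq (svalP p).
have N0 := mass_gt0 t (svalP p).
pose b : R := (4 * D + 2) * (size A).+1%:R.
have b0 : 0 <= b by rewrite mulr_ge0//; move: D0; lra.
have [|||h h0 [hr hK]] := @exists_small (1 + b * 11) (Num.min r 1)
  (e * mass t (sval p)).
- by lra.
- by rewrite lt_min r0 ltr01.
- exact: mulr_gt0.
move: hr; rewrite le_min => /andP[hr h1].
exists (ball t h, [set q : VietM d W | wasserstein1 d (sval p) (sval q) < h]).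
  by split; [exact: nbhsx_ballx|exact: nbhs_vietM].
move=> [t' q] [/= tt' /(wasserstein1_nearby (svalP p) (svalP q))[c pq ch]].
apply: eP => /=.
have c0 := nearby_ge0 dm pq.
have Aq := rA c _ (lt_le_trans ch hr) pq.
have c1 : c <= 1 by lra.
apply: le_lt_trans
  (blend_wasserstein t t' (svalP p) (svalP q) pq c1 uA Ap Aq) _.
rewrite ltr_pdivrMr//; apply: le_lt_trans hK.
rewrite mulrA -/b.
have : b * (6 * `|t - t'| + 5 * c) <= b * (11 * h).
  rewrite ler_wpM2l//; move: tt'; rewrite /ball/=; lra.
have -> : (1 + b * 11) * h = h + b * (11 * h) by ring.
by lra.
Qed.

Lemma viet_to_metric_continuous : continuous (@viet_to_metric R X d W).
Proof.
apply: viet_continuous => s p B ss sp /(vietM_nbhs dm)[e e0 eP].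
pose u := undup s; pose M := D * (size u)%:R.
have M0 : 0 <= M by rewrite mulr_ge0// ltW.
have [|h h0 [_ hK]] := @exists_small M 1 e M0 _ e0; first by [].
exists h => // q sq pq; apply: eP; apply: le_lt_trans hK.
apply: nearby_wasserstein1 => //; apply: simplex_nearby.
- by have [U WU sU] := ss; exists U => // x; rewrite mem_undup; exact: sU.
- exact: undup_uniq.
- exact: svalP.
- exact: svalP.
- by move=> x /sp; rewrite mem_undup.
- by move=> x /sq; rewrite mem_undup.
- by move=> x; exact: ltW.
Qed.

Lemma blend_point1 p : blend_point (1, p) = p.
Proof. by case: p => f pf; apply: eq_exist; exact: blend1. Qed.

(** As the natural map is the identity on points, both composites are [blend_point] at time 0. The
    same formula, continuous for either topology, deforms each of them to the identity at time 1. *)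
Lemma viet_to_metric_equivalence :
  homotopy_equivalence R (@viet_to_metric R X d W).
Proof.
split; first exact: viet_to_metric_continuous.
exists (fun q : VietM d W => blend_point (0, q) : Viet R W); split.
- exact: discretize_continuous.
- exists (blend_point : R * Viet R W -> Viet R W); split=> // [|s].
    exact: continuous_subspaceT viet_homotopy_continuous.
  exact: blend_point1.
- exists (blend_point : R * VietM d W -> VietM d W); split=> // [|s].
    exact: continuous_subspaceT vietM_homotopy_continuous.
  exact: blend_point1.
Qed.

End Main.

Theorem theorem3p1 (R : realType) (X : choiceType) (d : X -> X -> R)
  (W : set (set X)) :
  polish_metric d -> finite_dimensional d ->
  open_cover d W -> uniformly_bounded d W ->
  homotopy_equivalence R (@viet_to_metric R X d W).
Proof.
move=> [dm sep _] _ Wc [D [D0 WD]].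
have [kappa [kappa01 kappa_fin kappa_dense]] := exists_dense_weight sep.
have [F [k [[F01 k01] Fk FW Fcov]]] := exists_bumps dm sep Wc.
apply: (viet_to_metric_equivalence dm D0 _ F01 k01 Fk FW Fcov kappa01
  kappa_fin kappa_dense) => U WU x y Ux Uy.
rewrite -lee_fin; apply: le_trans (ltW (WD U WU)).
by apply: ereal_sup_ubound; exists x => //; exists y.
Qed.
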